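(* Let $\mathcal{D}$ be a null decomposition of $D^4$, identified with $D^2\times D^2$, consisting of recursively starlike-equivalent decomposition elements of filtration length one. Suppose the decomposition elements are disjoint from the boundary of $D^2\times D^2$ (although they may converge to it) and, further, that $S^1\times D^2\subset\partial(D^2\times D^2)$ has a closed neighbourhood $C$ (in $D^2\times D^2$) disjoint from the decomposition elements. Then there is a homeomorphism \[ h\colon (D^2\times D^2,\ S^1\times D^2)\xrightarrow{\ \cong\ }\big((D^2\times D^2)/\mathcal{D},\ S^1\times D^2\big) \] restricting to the identity on $C\cup\partial(D^2\times D^2)$.
   Context: A decomposition $\mathcal{D}$ of a space $X$ is a collection of pairwise disjoint subsets of $X$. $X/\mathcal{D}$ is the quotient space obtained by collapsing each element of $\mathcal{D}$ to a distinct point, and $\pi\colon X\to X/\mathcal{D}$ is the quotient map. For a nonempty subset $A\subset X$, $X/A$ denotes the quotient space collapsing $A$ to a point. Subsets of $X$ disjoint from all elements of $\mathcal{D}$ (here $S^1\times D^2$, $C$ and $\partial(D^2\times D^2)$) are identified with their images under $\pi$; thus ''$h$ restricts to the identity on $A$'' means $h|_A=\pi|_A$. A collection of subsets of a metric space is null if for every $\varepsilon>0$ only finitely many of its members have diameter greater than $\varepsilon$. A neighbourhood of a subset $S$ of a space $X$ is a subset $V\subset X$ for which there is an open set $O$ with $S\subset O\subset V$. $D^n\subset\mathbb{R}^n$ is the closed unit disc, $\operatorname{Int}D^n$ its interior, $S^{n-1}$ its boundary. A subset $E\subset \operatorname{Int}D^n$ is starlike if there are a point $O_E\in E$ (the origin)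 and an upper semi-continuous function $\rho_E\colon S^{n-1}\to[0,\infty)$ such that $E=\{O_E+t\xi\mid \xi\in S^{n-1},\ 0\le t\le\rho_E(\xi)\}$. A subset $E$ of a topological space $X$ is starlike-equivalent if, for some $n$, there is a map $f\colon N(E)\to\operatorname{Int}D^n$ from a closed neighbourhood $N(E)$ of $E$, which is a homeomorphism to its image and such that $f(E)$ is starlike. An origin for such an $E$ is $f^{-1}(O)$, where $O$ is an origin for $f(E)$; neither $f$ nor the origin need be unique. A subset $E$ of a topological space $X$ is recursively starlike-equivalent of filtration length $N$ if there is a finite filtration $\{e\}=E_{N+1}\subset E_N\subset\cdots\subset E_1\subset E_0=E$ by closed subsets $E_i$ such that, for each $0\le i\le N$, the set $E_i/E_{i+1}\subset X/E_{i+1}$ is starlike-equivalent and the point $E_{i+1}/E_{i+1}$ may be taken to be the origin of $E_i/E_{i+1}$. Here $N=1$.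
   Formalization: In ''starlike-equivalent'' the image f(N(E)) is also required to be a neighbourhood of f(E) in R^n (in effect n = 4); with charts into higher-dimensional discs allowed, a wild arc in D^4 with non-simply-connected complement is a counterexample. *)

(* Defs.v *)
From HB Require Import structures.
From mathcomp Require Import all_boot all_order all_algebra.
From mathcomp Require Import all_classical all_reals all_analysis.

Set Implicit Arguments.
Unset Strict Implicit.
Unset Printing Implicit Defensive.

Import Order.TTheory GRing.Theory Num.Theory.
Import numFieldNormedType.Exports.

Local Open Scope classical_set_scope.
Local Open Scope ring_scope.
Local Open Scope quotient_scope.

(** * Decompositions and quotient spaces *)

Record decomposition (X : Type) := Decomposition {
  elements :> set (set X);
  elements_disjoint : trivIset elements id }.

Section quotient.
Context {X : topologicalType} (D : decomposition X).

Definition dec_rel (x y : X) : bool :=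
  `[< x = y \/ exists2 E, elements D E & E x /\ E y >].

Lemma dec_rel_refl : reflexive dec_rel.
Proof. by move=> x; apply/asboolP; left. Qed.

Lemma dec_rel_sym : symmetric dec_rel.
Proof.
by move=> x y; apply/asboolP/asboolP => -[->|[E DE [Ex Ey]]];
  [left|right; exists E|left|right; exists E].
Qed.

Lemma dec_rel_trans : transitive dec_rel.
Proof.
move=> y x z /asboolP[->//|[E DE [Ex Ey]]] /asboolP[<-|[F DF [Fy Fz]]];
  apply/asboolP; right; exists E => //; split => //.
by rewrite (elements_disjoint DE DF) //; exists y.
Qed.

Definition dec_equiv := EquivRel _ dec_rel_refl dec_rel_sym dec_rel_trans.

(* X/D with the quotient topology *)
Definition dec_quot : Type := {eq_quot dec_equiv}.

HB.instance Definition _ :=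
  Topological.copy dec_quot (quotient_topology {eq_quot dec_equiv}).
HB.instance Definition _ := Quotient.on dec_quot.

Definition dec_pi : X -> dec_quot := \pi_dec_quot.

End quotient.

Lemma singleton_disjoint (X : Type) (A : set X) : trivIset [set A] id.
Proof. by move=> B C /= -> ->. Qed.

(* X/A is [dec_quot (collapse A)]. *)
Definition collapse (X : Type) (A : set X) : decomposition X :=
  Decomposition (@singleton_disjoint X A).

(** * Neighbourhoods, homeomorphisms, null collections *)

Definition neighbourhood (X : topologicalType) (S V : set X) : Prop :=
  exists O, [/\ open O, S `<=` O & O `<=` V].

Definition homeomorphism (X Y : topologicalType) (f : X -> Y) : Prop :=
  continuous f /\ exists g, [/\ continuous g, cancel f g & cancel g f].

Definition homeomorphism_onto_image (X Y : topologicalType) (N : set X)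
    (f : X -> Y) : Prop :=
  {within N, continuous f} /\
  exists g : Y -> X,
    {within f @` N, continuous g} /\ (forall x, N x -> g (f x) = x).

Definition diameter (R : realType) (X : Type) (d : X -> X -> R) (A : set X) :
    \bar R :=
  ereal_sup [set (d p.1 p.2)%:E | p in A `*` A].

Definition null_collection (R : realType) (X : Type) (d : X -> X -> R)
    (D : set (set X)) : Prop :=
  forall e : R, 0 < e -> finite_set [set E | D E /\ (e%:E < diameter d E)%E].

(** * Euclidean discs and spheres *)

(* The library norm on ['rV[R]_n] is the sup norm; it induces the same topology
   but its unit ball is a cube. *)
Definition enorm (R : realType) (n : nat) (v : 'rV[R]_n) : R :=
  Num.sqrt (\sum_i v ord0 i ^+ 2).

Definition disc (R : realType) (n : nat) : set 'rV[R]_n :=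
  [set v | enorm v <= 1].

Definition int_disc (R : realType) (n : nat) : set 'rV[R]_n :=
  [set v | enorm v < 1].

Definition sphere (R : realType) (n : nat) : set 'rV[R]_n :=
  [set v | enorm v = 1].

(** * Starlike sets *)

Definition upper_semicontinuous (R : realType) (X : topologicalType)
    (f : X -> R) : Prop :=
  forall x a, f x < a -> exists2 V, nbhs x V & forall y, V y -> f y < a.

Definition starlike (R : realType) (n : nat) (E : set 'rV[R]_n) (O : 'rV[R]_n)
    : Prop :=
  [/\ E `<=` @int_disc R n, E O &
   exists rho : @sphere R n -> R,
     [/\ forall xi, 0 <= rho xi, upper_semicontinuous rho &
      E = [set v | exists xi t,
             0 <= t <= rho xi /\ v = O + t *: (val xi : 'rV[R]_n)]]].

(* [starlike_equivalent R E p]: E is starlike-equivalent and p may be taken as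
   an origin.  The chart f carries N to a neighbourhood of f(E) in R^n.  If N
   could have positive codimension in R^n, every arc in the interior of D^4
   would qualify, being straightened in D^5 by Klee's trick; among these is
   Blankinship's wild arc, whose complement is not simply connected and whose
   quotient is therefore not D^4. *)
Definition starlike_equivalent (R : realType) (X : topologicalType)
    (E : set X) (p : X) : Prop :=
  exists (n : nat) (N : set X) (f : X -> 'rV[R]_n),
    [/\ closed N /\ neighbourhood E N,
        f @` N `<=` @int_disc R n,
        homeomorphism_onto_image N f /\ neighbourhood (f @` E) (f @` N),
        E p &
        starlike (f @` E) (f p)].

(* E_i/E_{i+1} is the image of E_i in X/E_{i+1}.  As e lies in E_{i+1}, its
   image is the point E_{i+1}/E_{i+1}. *)
Definition recursively_starlike_equivalent (R : realType) (X : topologicalType)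
    (L : nat) (E : set X) : Prop :=
  exists (e : X) (F : nat -> set X),
    [/\ F 0%N = E,
        F L.+1 = [set e],
        forall i, (i <= L)%N -> F i.+1 `<=` F i,
        forall i, (i <= L.+1)%N -> closed (F i) &
        forall i, (i <= L)%N ->
          let q := @dec_pi X (collapse (F i.+1)) in
          starlike_equivalent R (q @` F i) (q e)].

(** * D^2 x D^2 *)

Definition bidisc (R : realType) : topologicalType :=
  (@disc R 2 * @disc R 2)%type.

Definition bidisc_dist (R : realType) (x y : bidisc R) : R :=
  Num.sqrt (enorm (val x.1 - val y.1 : 'rV[R]_2) ^+ 2 +
            enorm (val x.2 - val y.2 : 'rV[R]_2) ^+ 2).

(* S^1 x D^2 *)
Definition attaching_region (R : realType) : set (bidisc R) :=
  [set x | @sphere R 2 (val x.1)].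

(* S^1 x D^2 together with D^2 x S^1 *)
Definition bidisc_boundary (R : realType) : set (bidisc R) :=
  [set x | @sphere R 2 (val x.1) \/ @sphere R 2 (val x.2)].

(* Main.v *)
Require Import Defs.
From mathcomp Require Import all_boot all_order all_algebra.
From mathcomp Require Import all_classical all_reals all_analysis.
From mathcomp Require Import ring lra.

(** An element E is collapsed exactly rather than approximately shrunk: if E is
    starlike about o in a chart, the radial map
    [v |-> o + w(dist(v, E)) (v - o)], with w increasing from 0 to 1, has E as
    its only nondegenerate fibre and is the identity away from E.  By nullity w
    may be chosen so slowly varying along the other elements that those it moves
    become arbitrarily small.  If E is recursively starlike-equivalent of length
    one, collapse E_1 first; the image of E is then starlike-equivalent and is
    collapsed in turn.

    Collapsing at stage n the finitely many elements whose current image has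
    diameter larger than M/2^n yields maps P_n that converge uniformly.  The
    limit F is constant on the elements.  Conversely its fibres are no larger,
    because the displacements at stage n are chosen to lie in a rapidly
    shrinking sequence of entourages of the quotient X/D.  Hence F induces a
    homeomorphism from X/D to X whose inverse is h. *)

Set Implicit Arguments.
Unset Strict Implicit.
Unset Printing Implicit Defensive.

Import Order.TTheory GRing.Theory Num.Theory.
Import numFieldNormedType.Exports.

Local Open Scope classical_set_scope.
Local Open Scope ring_scope.

(** * Compact metric spaces *)

(** The metric is a bare function tied to a given topology by [nbhs_dP], so the topology of the
    statement is kept and the metric can be chosen for convenience. *)
Record compact_metric (R : realType) (X : topologicalType) (d : X -> X -> R) :
    Prop := CompactMetric {
  dxx : forall x, d x x = 0;
  d_eq0 : forall x y, d x y = 0 -> x = y;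
  dC : forall x y, d x y = d y x;
  d_triangle : forall x y z, d x z <= d x y + d y z;
  nbhs_dP : forall x V,
    nbhs x V <-> exists2 e : R, 0 < e & forall y, d x y < e -> V y;
  d_compact : compact [set: X] }.

Section compact_metric_theory.
Context (R : realType) (X : topologicalType) (d : X -> X -> R).
Hypothesis dX : compact_metric d.
Implicit Types (e r s : R).

Lemma d_ge0 x y : 0 <= d x y.
Proof. by have := d_triangle dX x y x; rewrite (dxx dX) (dC dX y x); lra. Qed.

Lemma d_gt0 x y : x <> y -> 0 < d x y.
Proof.
move=> xy; rewrite lt_neqAle d_ge0 andbT eq_sym.
by apply/negP => /eqP /(d_eq0 dX).
Qed.

Lemma open_dP (O : set X) :
  open O <-> forall x, O x -> exists2 e, 0 < e & forall y, d x y < e -> O y.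
Proof.
rewrite openE; split => [Oo x /Oo /(nbhs_dP dX) //|H x /H ?].
exact/(nbhs_dP dX).
Qed.

Lemma open_nbhd (E : set X) r : open [set x | exists2 a, E a & d a x < r].
Proof.
apply/open_dP => x [a Ea axr]; exists (r - d a x); first by lra.
by move=> y xy; exists a => //; have := d_triangle dX a x y; lra.
Qed.

Lemma continuous_dP (f : X -> X) : continuous f <->
  forall x e, 0 < e -> exists2 r, 0 < r & forall y, d x y < r -> d (f x) (f y) < e.
Proof.
split => [fc x e e0|H x V].
  have /fc : nbhs (f x) [set y | d (f x) y < e] by apply/(nbhs_dP dX); exists e.
  by move=> /(nbhs_dP dX)[r r0 Hr]; exists r.
move=> /(nbhs_dP dX)[e e0 He].
have [r r0 Hr] := H x e e0.
by apply/(nbhs_dP dX); exists r => // y /Hr /He.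
Qed.

Lemma cluster_sequence (u : nat -> X) :
  exists x, forall e N, 0 < e -> exists2 n, (N <= n)%N & d x (u n) < e.
Proof.
have [x [_ xu]] : [set: X] `&` cluster (u @ \oo) !=set0.
  by apply: (d_compact dX); exact: filterT.
exists x => e N e0.
have [||_ [[n /= Nn <-] xn]] :=
  xu [set u n | n in [set n | (N <= n)%N]] [set y | d x y < e].
- by exists N => // n /= Nn; exists n.
- by apply/(nbhs_dP dX); exists e.
by exists n.
Qed.

Lemma closed_dP (A : set X) : closed A <->
  forall x, (forall e, 0 < e -> exists2 a, A a & d x a < e) -> A x.
Proof.
split=> [Ac x H|H x clx].
  apply: Ac => V /(nbhs_dP dX)[e e0 He].
  by have [a Aa /He Va] := H e e0; exists a.
apply: H => e e0.
have [|a [Aa ae]] := clx [set y | d x y < e].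
  by apply/(nbhs_dP dX); exists e.
by exists a.
Qed.

Lemma d_hausdorff : hausdorff_space X.
Proof.
move=> x y xy; apply: contrapT => /d_gt0 e0.
have [||z [/= zx zy]] := xy [set z | d x z < d x y / 2] [set z | d y z < d x y / 2].
- by apply/(nbhs_dP dX); exists (d x y / 2) => //; lra.
- by apply/(nbhs_dP dX); exists (d x y / 2) => //; lra.
have := d_triangle dX x z y; rewrite (dC dX z y); lra.
Qed.

Lemma closed_image (f : X -> X) (A : set X) :
  continuous f -> closed A -> closed (f @` A).
Proof.
move=> fc Ac; apply: compact_closed; first exact: d_hausdorff.
apply: continuous_compact; first exact: continuous_subspaceT.
exact: subclosed_compact Ac (d_compact dX) _.
Qed.

Lemma cluster_subsequence (u : nat -> X) : exists x (phi : nat -> nat),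
  forall k, (k <= phi k)%N /\ d x (u (phi k)) < k.+1%:R^-1.
Proof.
have [x xu] := cluster_sequence u; exists x.
have /choice[phi Hphi] : forall k, exists n,
    (k <= n)%N /\ d x (u n) < k.+1%:R^-1.
  by move=> k; have [|n] := xu k.+1%:R^-1 k; [rewrite invr_gt0|exists n].
by exists phi.
Qed.

(** Subsequences are extracted one inside the other; the bounds survive because the index maps never
    lower an index. *)
Lemma cluster_triple (u v w : nat -> X) : exists a b c (phi : nat -> nat),
  forall k, [/\ (k <= phi k)%N, d a (u (phi k)) < k.+1%:R^-1,
    d b (v (phi k)) < k.+1%:R^-1 & d c (w (phi k)) < k.+1%:R^-1].
Proof.
have [a [f Hf]] := cluster_subsequence u.
have [b [g Hg]] := cluster_subsequence (v \o f).
have [c [h Hh]] := cluster_subsequence (w \o f \o g).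
exists a, b, c, (f \o g \o h) => k.
have anti i j : (i <= j)%N -> j.+1%:R^-1 <= i.+1%:R^-1 :> R.
  by move=> ij; rewrite lef_pV2 ?posrE ?ltr0n // ler_nat ltnS.
have [kh wk] := Hh k; have [hg vk] := Hg (h k); have [gf uk] := Hf (g (h k)).
have kg := leq_trans kh hg.
split => //=; first exact: leq_trans kg gf.
  exact: lt_le_trans uk (anti _ _ kg).
exact: lt_le_trans vk (anti _ _ kh).
Qed.

Lemma cluster_closed (A : set X) (u : nat -> X) x : closed A ->
  (forall n, A (u n)) ->
  (forall e N, 0 < e -> exists2 n, (N <= n)%N & d x (u n) < e) -> A x.
Proof.
move=> /closed_dP Ac Au xu; apply: Ac => e e0.
by have [n _ nx] := xu e 0%N e0; exists (u n).
Qed.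

(** A Lebesgue number principle: points of [A] where [P] fails at [1/(n+1)] would cluster at a point
    of [A] whose local radius is eventually larger. *)
Lemma uniform_constant (P : X -> R -> Prop) (A : set X) : closed A ->
  (forall x r s, P x r -> s <= r -> P x s) ->
  (forall x, A x ->
     exists2 r, 0 < r & forall y, A y -> d x y < r -> P y r) ->
  exists2 r, 0 < r & forall x, A x -> P x r.
Proof.
move=> Ac Pmono Ploc; apply: contrapT => H.
have {}H n : exists x, A x /\ ~ P x n.+1%:R^-1.
  apply: contrapT => K; apply: H; exists n.+1%:R^-1; first by rewrite invr_gt0.
  by move=> x Ax; apply: contrapT => Px; apply: K; exists x.
have [u Hu] := choice H.
have [x xu] := cluster_sequence u.
have Ax : A x by apply: cluster_closed xu => // n; case: (Hu n).
have [r r0 Hr] := Ploc x Ax.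
have [n Nn xn] := xu r (Num.trunc r^-1) r0.
have [Aun []] := Hu n.
apply: Pmono (Hr _ Aun xn) _.
rewrite -[leRHS]invrK lef_pV2 ?posrE ?invr_gt0 //.
by apply: (le_trans (ltW (truncnS_gt _))); rewrite ler_nat ltnS.
Qed.

Lemma unif_cont (f : X -> X) : continuous f -> forall e, 0 < e ->
  exists2 r, 0 < r & forall x y, d x y < r -> d (f x) (f y) < e.
Proof.
move=> /continuous_dP fc e e0.
have [||//|r r0 Hr] := @uniform_constant
  (fun x r => forall y, d x y < r -> d (f x) (f y) < e) setT.
- exact: closedT.
- by move=> x r s Pr sr y xy; apply: Pr; lra.
- move=> x _; have [|r r0 Hr] := fc x (e / 2); first by lra.
  exists (r / 2); first by lra.
  move=> y _ xy z yz.
  have := d_triangle dX x y z; have := d_triangle dX (f y) (f x) (f z).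
  have := Hr y; have := Hr z; rewrite (dC dX (f y) (f x)) => Hz Hy.
  by move=> ? ?; have := Hz ltac:(lra); have := Hy ltac:(lra); lra.
by exists r => // x y; exact: Hr.
Qed.

Lemma d_bounded : exists2 M, 0 < M & forall x y, d x y <= M.
Proof.
have [[z _]|X0] := pselect (exists z : X, True); last first.
  by exists 1 => // x; exfalso; apply: X0; exists x.
(* An upper bound becomes a positive constant by passing to its reciprocal. *)
have [||//|r r0 Hr] := @uniform_constant (fun x r => r * d z x <= 1) setT.
- exact: closedT.
- by move=> x r s rx sr; apply: le_trans rx; rewrite ler_wpM2r // d_ge0.
- move=> x _; have zx := d_ge0 z x.
  exists (1 + d z x)^-1 => [|y _ xy]; first by rewrite invr_gt0; lra.
  have r1 : (1 + d z x)^-1 <= 1 by rewrite invf_le1; lra.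
  rewrite ler_pdivrMl; last by lra.
  by have := d_triangle dX z x y; lra.
exists (2 / r) => [|x y]; first by rewrite divr_gt0.
rewrite ler_pdivlMr // mulrC.
have := Hr x I; have := Hr y I.
have := ler_wpM2l (ltW r0) (d_triangle dX x z y).
by rewrite (dC dX x z) mulrDr; lra.
Qed.

Lemma thick_nbhd (E O : set X) : closed E -> open O -> E `<=` O ->
  exists2 r, 0 < r & forall a y, E a -> d a y < r -> O y.
Proof.
move=> Ec /open_dP Oo EO.
have [x r s Pr sr y xy|x Ex|r r0 Hr] := @uniform_constant
  (fun x r => forall y, d x y < r -> O y) E Ec.
- by apply: Pr; lra.
- have [r r0 Hr] := Oo x (EO x Ex).
  exists (r / 2) => [|y Ey xy z yz]; first by lra.
  by apply: Hr; have := d_triangle dX x y z; lra.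
by exists r => // a y Ea; exact: Hr.
Qed.

Lemma separation (A B : set X) : closed A -> closed B -> A `&` B = set0 ->
  exists2 r, 0 < r & forall a b, A a -> B b -> r <= d a b.
Proof.
move=> Ac Bc AB.
have [||r r0 Hr] := @thick_nbhd A (~` B) Ac.
- exact: closed_openC.
- by apply/disjoints_subset.
exists r => // a b Aa Bb; rewrite leNgt; apply/negP => ab.
exact: Hr Aa ab Bb.
Qed.

End compact_metric_theory.

(** * Staircase functions and distance to a set *)

Section staircase.
Context (R : realType).
Implicit Types (r s a b : R) (w : R -> R).

Definition ramp r s a : R := Num.min 1 (Num.max 0 ((a - r) / (s - r))).

Lemma ramp_ge0 r s a : 0 <= ramp r s a.
Proof. by rewrite le_min ler01 le_max lexx. Qed.

Lemma ramp_le1 r s a : ramp r s a <= 1.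
Proof. by rewrite ge_min lexx. Qed.

Lemma ramp_eq0 r s a : r < s -> a <= r -> ramp r s a = 0.
Proof.
move=> rs ar; rewrite /ramp max_l ?min_r ?ler01 //.
by rewrite ler_pdivrMr ?mul0r; lra.
Qed.

Lemma ramp_gt0 r s a : r < s -> r < a -> 0 < ramp r s a.
Proof. by move=> rs ra; rewrite lt_min ltr01 lt_max divr_gt0 ?orbT; lra. Qed.

Lemma ramp_eq1 r s a : r < s -> s <= a -> ramp r s a = 1.
Proof.
move=> rs sa; rewrite /ramp min_l // le_max ler_pdivlMr ?mul1r; last by lra.
by apply/orP; right; lra.
Qed.

Lemma ramp_nondecreasing r s a b : r < s -> a <= b -> ramp r s a <= ramp r s b.
Proof.
move=> rs ab; rewrite /ramp; apply: le_min2 => //; apply: le_max2 => //.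
by rewrite ler_pM2r ?invr_gt0; lra.
Qed.

Lemma ramp_lipschitz r s a b : r < s -> a <= b ->
  ramp r s b - ramp r s a <= (s - r)^-1 * (b - a).
Proof.
move=> rs ab; set k := (s - r)^-1.
have k0 : 0 < k by rewrite invr_gt0; lra.
have -> : k * (b - a) = (b - r) * k - (a - r) * k by ring.
rewrite /ramp -/k.
have : (a - r) * k <= (b - r) * k by rewrite ler_pM2r; lra.
move: (_ * k) (_ * k) => u v uv; rewrite /Num.min /Num.max.
by case: (ltP 0 u) => ?; case: (ltP 0 v) => ?; repeat case: ltP => ?; lra.
Qed.

(* If the levels descend fast enough, each member of [AA] meets at most two
   consecutive treads, so it sees a height difference of at most 2. *)
Lemma staircase (AA : set (set R)) :
  (forall r, 0 < r -> exists2 s, 0 < s &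
     forall A a b, AA A -> A a -> A b -> a < s -> b < r) ->
  forall m r, 0 < r -> exists w,
  [/\ forall a b, a <= b -> w a <= w b,
      exists K, forall a b, a <= b -> w b - w a <= K * (b - a),
      forall a, a <= 0 -> w a = 0,
      forall a, 0 < a -> 0 < w a &
      forall a, r <= a -> w a = m.+1%:R] /\
  (forall A a b, AA A -> A a -> A b -> w a - w b <= 2) /\
  (forall A a b c, AA A -> A a -> A b -> A c -> r <= c -> w a - w b <= 1).
Proof.
move=> HA; elim=> [|m IH] r r0.
  exists (ramp 0 r); split; [split => [||a|a|a]|split].
  - by move=> a b; exact: ramp_nondecreasing.
  - by eexists => a b; exact: ramp_lipschitz.
  - exact: ramp_eq0.
  - exact: ramp_gt0.
  - exact: ramp_eq1.
  - move=> A a b _ _ _.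
    by have := ramp_le1 0 r a; have := ramp_ge0 0 r b; lra.
  - move=> A a b c _ _ _ _ _.
    by have := ramp_le1 0 r a; have := ramp_ge0 0 r b; lra.
have [s' s'0 Hs'] := HA r r0.
(* The staircase from the induction is fitted below [s] and one more ramp is added between [s] and
   [r]; a member of [AA] reaching [r] never falls below [s]. *)
pose s := Num.min s' (r / 2).
have s0 : 0 < s by rewrite lt_min s'0; lra.
have ss' : s <= s' by rewrite ge_min lexx.
have sr : s < r by apply: (@le_lt_trans _ _ (r / 2)); [rewrite ge_min lexx orbT|lra].
have {Hs'}Hs A a b : AA A -> A a -> A b -> a < s -> b < r.
  by move=> AA1 Aa Ab as_; apply: Hs' AA1 Aa Ab _; lra.
have [w [[w_nd [K wK] w0 wpos w_top] [w2 w1]]] := IH s s0.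
exists (fun a => w a + ramp s r a); split; [split => [||a a0|a a0|a ra]|split].
- by move=> a b ab; apply: lerD; [exact: w_nd|exact: ramp_nondecreasing].
- exists (K + (r - s)^-1) => a b ab; rewrite mulrDl.
  have := wK _ _ ab; have := ramp_lipschitz sr ab; lra.
- by rewrite w0 // ramp_eq0 ?addr0 //; lra.
- by have := wpos a a0; have := ramp_ge0 s r a; lra.
- by rewrite w_top ?ramp_eq1 ?natr1 //; lra.
- move=> A a b AA1 Aa Ab.
  (* If [A] reaches [s], the lower staircase varies by at most 1 on it, by the sharper clause, and
     the ramp by at most 1; otherwise the ramp vanishes on [A]. *)
  have [[c Ac sc]|Hc] := pselect (exists2 c, A c & s <= c).
    have := w1 A a b c AA1 Aa Ab Ac sc.
    by have := ramp_le1 s r a; have := ramp_ge0 s r b; lra.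
  have as_ : a <= s by rewrite leNgt; apply/negP => sa; apply: Hc; exists a => //; lra.
  have bs : b <= s by rewrite leNgt; apply/negP => sb; apply: Hc; exists b => //; lra.
  by rewrite !ramp_eq0 // !addr0; exact: w2 AA1 Aa Ab.
- move=> A a b c AA1 Aa Ab Ac rc.
  have top x : A x -> w x = m.+1%:R.
    move=> Ax; apply: w_top; rewrite leNgt; apply/negP => xs.
    have := Hs A x c AA1 Ax Ac xs; lra.
  rewrite !top //.
  by have := ramp_le1 s r a; have := ramp_ge0 s r b; lra.
Qed.

End staircase.

(** * Distance to a starlike set in a normed space *)

Section set_distance.
Context (R : realType) (V : normedModType R) (S : set V) (o : V).
Hypothesis So : S o.

Definition set_distance (v : V) : R := inf [set `|v - s| | s in S].

Lemma set_distance_lb v : has_lbound [set `|v - s| | s in S].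
Proof. by exists 0 => _ [s _ <-]. Qed.

Lemma set_distance_le v s : S s -> set_distance v <= `|v - s|.
Proof. by move=> Ss; apply: (ge_inf (set_distance_lb v)); exists s. Qed.

Lemma set_distance_ge v r : (forall s, S s -> r <= `|v - s|) -> r <= set_distance v.
Proof.
move=> H; apply: lb_le_inf; first by exists `|v - o|; exists o.
by move=> _ [s /H ? <-].
Qed.

Lemma set_distance_ge0 v : 0 <= set_distance v.
Proof. exact: set_distance_ge. Qed.

Lemma set_distance_lt v r : set_distance v < r -> exists2 s, S s & `|v - s| < r.
Proof.
move=> vr; apply: contrapT => H; move: vr; rewrite ltNge => /negP; apply.
apply: set_distance_ge => s Ss; rewrite leNgt; apply/negP => vs; apply: H.
by exists s.
Qed.

Lemma set_distance_lipschitz u v : set_distance u - set_distance v <= `|u - v|.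
Proof.
suff : set_distance u - `|u - v| <= set_distance v by lra.
apply: set_distance_ge => s Ss.
have := set_distance_le u Ss; have := ler_distD v u s; lra.
Qed.

Hypothesis S_star : forall s c, S s -> 0 <= c <= 1 -> S (o + c *: (s - o)).

(** The contraction by [c] about [o] maps [S] into itself and multiplies distances by [c]. *)
Lemma set_distance_star v c : 0 <= c <= 1 ->
  set_distance (o + c *: (v - o)) <= c * set_distance v.
Proof.
move=> /[dup] c01 /andP[]; rewrite le_eqVlt => /orP[/eqP <- _|c0 _].
  by rewrite scale0r addr0 mul0r (le_trans (set_distance_le _ So)) ?subrr ?normr0.
rewrite -ler_pdivrMl //; apply: set_distance_ge => s Ss.
rewrite ler_pdivrMl // (le_trans (set_distance_le _ (S_star Ss c01))) //.
rewrite -[X in X * _](ger0_norm (ltW c0)) -normrZ.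
by rewrite opprD addrACA subrr add0r -scalerBr opprB addrA subrK.
Qed.

End set_distance.

(** * Radial collapse of a starlike set *)

Section null_families.
Context (R : realType) (X : topologicalType) (d : X -> X -> R).
Implicit Types (A T : set X) (AA TT : set (set X)) (e : R).

Definition diam_le A e : Prop := forall x y, A x -> A y -> d x y <= e.

Definition null_family TT : Prop :=
  forall e, 0 < e -> finite_set [set T | TT T /\ ~ diam_le T e].

(** For a decomposition of a compact metric space, such a [p] is the quotient map up to
    homeomorphism; see [collapses_homeomorphism]. *)
Definition collapses (p : X -> X) AA : Prop :=
  [/\ continuous p, forall y, exists x, p x = y &
      forall x y, p x = p y <-> x = y \/ exists2 A, AA A & A x /\ A y].

Hypothesis dX : compact_metric d.

Lemma null_family_image (f : X -> X) TT : continuous f -> null_family TT ->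
  null_family [set f @` T | T in TT].
Proof.
move=> fc TTnull e e0; have [r r0 fr] := unif_cont dX fc e0.
apply: (@sub_finite_set _ _ [set f @` T | T in [set T | TT T /\ ~ diam_le T (r / 2)]]).
  move=> _ [[T TTT <-] Te]; exists T => //; split => // Tr; apply: Te.
  move=> _ _ [x Tx <-] [y Ty <-]; apply/ltW/fr; have := Tr x y Tx Ty; lra.
by apply: finite_image; apply: TTnull; lra.
Qed.

(** The finitely many members of diameter above [e / 2] have a closed union disjoint from [E], hence
    at positive distance from it; any member coming closer is small. *)
Lemma null_family_near TT E : null_family TT -> (forall T, TT T -> closed T) ->
  closed E -> (forall T, TT T -> E `&` T = set0) ->
  forall e, 0 < e -> exists2 r, 0 < r & forall T x a, TT T -> T x -> E a ->
    d a x < r -> diam_le T e /\ forall y, T y -> d a y < e.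
Proof.
move=> TTnull TTc Ec ET e e0.
have e2 : 0 < e / 2 by lra.
set B := [set T | TT T /\ ~ diam_le T (e / 2)].
have Bc : closed (\bigcup_(T in B) T).
  by apply: closed_bigcup; [exact: TTnull|move=> T [/TTc]].
have [|r r0 EB] := separation dX Ec Bc.
  rewrite -subset0 => x [Ex [T [TTT _] Tx]].
  by have := ET T TTT; rewrite -subset0; apply; split; [exact: Ex|].
exists (Num.min r (e / 2)); first by rewrite lt_min r0.
move=> T x a TTT Tx Ea; rewrite lt_min => /andP[ax ax2].
have Te : diam_le T (e / 2).
  apply: contrapT => Te; have := EB a x Ea (ex_intro2 _ _ T (conj TTT Te) Tx).
  lra.
split => [y z Ty Tz|y Ty]; first by have := Te y z Ty Tz; lra.
by have := d_triangle dX a x y; have := Te x y Tx Ty; lra.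
Qed.

End null_families.

(** * The radial map in a chart *)

Section radial_collapse.
Context (R : realType) (X : topologicalType) (d : X -> X -> R).
Hypothesis dX : compact_metric d.
Context (V : normedModType R) (N E U : set X) (f : X -> V) (p0 : X).
Implicit Types (e r s t c : R).
Hypotheses (N_closed : closed N) (E_closed : closed E) (U_open : open U).
Hypotheses (E_U : E `<=` U) (E_N : neighbourhood E N) (E_p0 : E p0).
Hypothesis f_inj : forall x y, N x -> N y -> f x = f y -> x = y.
Hypothesis f_cont : forall x e, N x -> 0 < e ->
  exists2 r, 0 < r & forall y, N y -> d x y < r -> `|f x - f y| < e.
Hypothesis f_bound : forall x, N x -> `|f x| <= 1.
Hypothesis fE_fN : neighbourhood (f @` E) (f @` N).
Hypothesis fE_star : forall v c, (f @` E) v -> 0 <= c <= 1 ->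
  (f @` E) (f p0 + c *: (v - f p0)).

Let E_sub_N : E `<=` N.
Proof. by case: E_N => O [_ EW WN] x /EW /WN. Qed.

Let f_unif e : 0 < e ->
  exists2 r, 0 < r & forall x y, N x -> N y -> d x y < r -> `|f x - f y| < e.
Proof.
move=> e0.
have [x r s Pr sr y Ny xy|x Nx|r r0 Hr] := @uniform_constant _ _ _ dX
  (fun x r => forall y, N y -> d x y < r -> `|f x - f y| < e) N N_closed.
- by apply: Pr => //; lra.
- have [|r r0 Hr] := f_cont Nx (e := e / 2); first by lra.
  exists (r / 2) => [|y Ny xy z Nz yz]; first by lra.
  have := d_triangle dX x y z; have := ler_distD (f x) (f y) (f z).
  rewrite (distrC (f y) (f x)).
  by have := Hr y Ny ltac:(lra); have := Hr z Nz; move=> Hz ? ? ?;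
    have := Hz ltac:(lra); lra.
by exists r => // x y Nx; exact: Hr.
Qed.

(** By compactness of [N], the distance from [f x] to [f y] is bounded below for [y] in [N] outside
    a ball about [x]; a second compactness argument makes the bound uniform in [x]. *)
Let f_inv_unif e : 0 < e ->
  exists2 r, 0 < r & forall x y, N x -> N y -> `|f x - f y| < r -> d x y < e.
Proof.
move=> e0.
have f_inv_cont x e' : N x -> 0 < e' ->
    exists2 r, 0 < r & forall y, N y -> `|f x - f y| < r -> d x y < e'.
  move=> Nx e'0; pose A := N `&` ~` [set y | exists2 a, a = x & d a y < e'].
  have Ac : closed A.
    by apply: closedI => //; apply: open_closedC; exact: (open_nbhd dX).
  have [y r s Pr sr|y [Ny xy]|r r0 Hr] := @uniform_constant _ _ _ dX
    (fun y r => r <= `|f x - f y|) A Ac.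
  - exact: le_trans sr Pr.
  - have fxy : 0 < `|f x - f y|.
      rewrite normr_gt0 subr_eq0; apply/eqP => /(f_inj Nx Ny) xE.
      by apply: xy; exists x => //; rewrite xE (dxx dX).
    have [|r r0 Hr] := f_cont Ny (e := `|f x - f y| / 2); first by lra.
    exists (Num.min r (`|f x - f y| / 2)); first by rewrite lt_min r0; lra.
    move=> z [Nz _]; rewrite lt_min => /andP[/(Hr z Nz) yz _].
    rewrite ge_min; apply/orP; right.
    have := ler_distD (f z) (f x) (f y); rewrite (distrC (f z)); lra.
  exists r => // y Ny xy; apply: contrapT => H.
  have := Hr y (conj Ny _); apply: contraPP => _ Hy; have : r <= `|f x - f y|.
    by apply: Hy => -[_ ->].
  by lra.
have [x r s Pr sr y Ny xy|x Nx|r r0 Hr] := @uniform_constant _ _ _ dX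
  (fun x r => forall y, N y -> `|f x - f y| < r -> d x y < e) N N_closed.
- by apply: Pr => //; lra.
- have [|r r0 Hr] := f_inv_cont x (e / 2) Nx; first by lra.
  have [|s s0 Hs] := f_cont Nx (e := r / 2); first by lra.
  pose t := Num.min (Num.min s (e / 2)) (r / 2).
  exists t => [|y Ny xy z Nz yz]; first by rewrite !lt_min s0; lra.
  have {}yz : `|f y - f z| < r / 2.
    by apply: lt_le_trans yz _; rewrite ge_min lexx orbT.
  move: xy; rewrite !lt_min => /andP[/andP[xs xe] _].
  have := Hs y Ny xs; have := ler_distD (f y) (f x) (f z).
  have := d_triangle dX y x z; rewrite (dC dX y x) => ? ? ?.
  by have := Hr z Nz ltac:(lra); lra.
by exists r => // x y Nx; exact: Hr.
Qed.

(** Compactness of [E] gives the neighbourhood a uniform width. This is where the codimension zero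
    of the chart enters: points produced in [V] near the image of [E] come from [N]. *)
Let tube : exists2 r, 0 < r & forall a v, E a -> `|f a - v| < r -> (f @` N) v.
Proof.
have [W [Wo EW WN]] := fE_fN.
have [x r s Pr sr y xy|x Ex|r r0 Hr] := @uniform_constant _ _ _ dX
  (fun x r => forall v, `|f x - v| < r -> (f @` N) v) E E_closed.
- by apply: Pr; lra.
- have : nbhs (f x) W by apply: open_nbhs_nbhs; split => //; apply: EW; exists x.
  move=> /nbhs_ballP[r /= r0 Hr].
  have [|s s0 Hs] := f_cont (E_sub_N Ex) (e := r / 2); first by lra.
  exists (Num.min s (r / 2)) => [|y Ey]; first by rewrite lt_min s0; lra.
  rewrite lt_min => /andP[xs _] v; rewrite lt_min => /andP[_ yv].
  apply/WN/Hr; rewrite -ball_normE /=.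
  have := Hs y (E_sub_N Ey) xs; have := ler_distD (f y) (f x) v; lra.
by exists r => // a v Ea; exact: Hr.
Qed.

Let sigma x := set_distance (f @` E) (f x).

Let fE_p0 : (f @` E) (f p0). Proof. by exists p0. Qed.

(** Together with [sigma_near_E], this makes metric neighbourhoods of [E] and sublevel sets of
    [sigma] interchangeable. *)
Let E_near_sigma r : 0 < r -> exists2 t, 0 < t &
  forall a y, E a -> d a y < t -> [/\ N y, U y & sigma y < r].
Proof.
move=> r0; have [W [Wo EW WN]] := E_N.
have [||t t0 Ht] := @thick_nbhd _ _ _ dX E (W `&` U) E_closed.
- exact: openI.
- by move=> x Ex; split; [exact: EW|exact: E_U].
have [s s0 Hs] := f_unif r0.
exists (Num.min t s) => [|a y Ea]; first by rewrite lt_min t0.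
rewrite lt_min => /andP[/(Ht a y Ea)[Wy Uy] ays]; split => //; first exact: WN.
apply: le_lt_trans (Hs y a (WN _ Wy) (E_sub_N Ea) _).
  by apply: set_distance_le; exists a.
by rewrite (dC dX).
Qed.

Let sigma_near_E t : 0 < t -> exists2 r, 0 < r &
  forall x, N x -> sigma x < r -> exists2 a, E a & d a x < t.
Proof.
move=> t0; have [r r0 Hr] := f_inv_unif t0.
exists r => // x Nx /(set_distance_lt fE_p0)[_ [a Ea <-] xa]; exists a => //.
by apply: Hr => //; [exact: E_sub_N|rewrite distrC].
Qed.

Let sigma_E x : N x -> sigma x <= 0 <-> E x.
Proof.
move=> Nx; split=> [x0|Ex]; last first.
  by rewrite -(normr0 V) -(subrr (f x)); apply: set_distance_le; exists x.
move: E_closed => /(closed_dP dX); apply => e e0.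
have [r r0 Hr] := sigma_near_E e0.
have [|a Ea ax] := Hr x Nx; first by lra.
by exists a => //; rewrite (dC dX).
Qed.

Let sigma_cont x e : N x -> 0 < e -> exists2 r, 0 < r &
  forall y, N y -> d x y < r -> sigma x < sigma y + e /\ sigma y < sigma x + e.
Proof.
move=> Nx e0; have [r r0 Hr] := f_cont Nx e0; exists r => // y Ny xy.
have xy' := Hr y Ny xy.
have := set_distance_lipschitz fE_p0 (f x) (f y).
have := set_distance_lipschitz fE_p0 (f y) (f x).
by rewrite (distrC (f y)) /sigma; split; lra.
Qed.

(* In the chart the collapse is [v |-> o + w(dist(v, f(E))) (v - o)].  Its only
   fibre with several points is f(E): since f(E) is starlike, the distance to it
   increases along the rays from [o]. *)
Section profile.
Context (w : R -> R) (r rstar : R).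
Hypotheses (r_gt0 : 0 < r) (r_rstar : r < rstar).
Hypothesis w_nd : forall a b, a <= b -> w a <= w b.
Hypothesis w_lip : exists K, forall a b, a <= b -> w b - w a <= K * (b - a).
Hypothesis w_eq0 : forall a : R, a <= 0 -> w a = 0.
Hypothesis w_gt0 : forall a : R, 0 < a -> 0 < w a.
Hypothesis w_eq1 : forall a, r <= a -> w a = 1.
Hypothesis rstar_tube : forall v, set_distance (f @` E) v < rstar -> (f @` N) v.
Hypothesis rstar_U : forall x, N x -> sigma x < rstar ->
  U x /\ exists2 t, 0 < t & forall y, d x y < t -> N y.

Let B := [set x | N x /\ sigma x < rstar].
Let o := f p0.

Let w_01 a : 0 <= w a <= 1.
Proof.
apply/andP; split; first by rewrite -(@w_eq0 (Num.min a 0)) ?w_nd ?ge_min ?lexx ?orbT.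
by rewrite -(@w_eq1 (Num.max a r)) ?w_nd ?le_max ?lexx ?orbT.
Qed.

Let radial v := o + w (set_distance (f @` E) v) *: (v - o).

(** Pulling towards [o] does not increase the distance to the starlike image, so [radial] preserves
    the sublevel set at [rstar], which the chart covers by [rstar_tube]. *)
Let radial_def : exists p : X -> X, forall x,
  (B x -> B (p x) /\ f (p x) = radial (f x)) /\ (~ B x -> p x = x).
Proof.
suff /choice[p Hp] : forall x, exists y,
    (B x -> B y /\ f y = radial (f x)) /\ (~ B x -> y = x) by exists p.
move=> x.
have [[Nx xr]|Bx] := pselect (B x); last by exists x.
have yr : set_distance (f @` E) (radial (f x)) < rstar.
  apply: le_lt_trans (set_distance_star fE_p0 fE_star (f x) (w_01 _)) _.
  have /andP[? ?] := w_01 (sigma x); have := set_distance_ge0 fE_p0 (f x).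
  move=> s0; apply: le_lt_trans xr; rewrite -[leRHS]mul1r.
  exact: ler_wpM2r.
have [y Ny fy] := rstar_tube yr.
exists y; split=> [_|[]//]; split=> //; split=> //.
by rewrite /sigma fy.
Qed.

Lemma radial_collapse : exists p : X -> X,
  [/\ collapses p [set E],
      forall x, p x <> x -> U x /\ U (p x),
      forall x, ~ (N x /\ sigma x < r) -> p x = x &
      forall x y, N x /\ sigma x < rstar -> N y /\ sigma y < rstar ->
        [/\ N (p x), N (p y) & `|f (p x) - f (p y)| <=
          2 * `|w (sigma x) - w (sigma y)| + `|f x - f y|]].
Proof.
have [r0 rr] := (r_gt0, r_rstar).
have [p Hp] := radial_def.
have pB x : B x -> B (p x) by case/(proj1 (Hp x)).
have fpB x : B x -> f (p x) = radial (f x) by case/(proj1 (Hp x)).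
have pC x : ~ B x -> p x = x by exact: proj2 (Hp x).
have BN x : B x -> N x by case.
have p_id x : ~ (N x /\ sigma x < r) -> p x = x.
  move=> xr; have [Bx|/pC//] := pselect (B x).
  apply: f_inj; [exact/BN/pB|exact: BN|].
  rewrite fpB // /radial w_eq1 ?scale1r ?subrKC //.
  by rewrite leNgt; apply/negP => ?; apply: xr; split => //; exact: BN.
have pU x : p x <> x -> U x /\ U (p x).
  have [Bx _|/pC//] := pselect (B x).
  have BU y : B y -> U y by case=> Ny /(rstar_U Ny)[].
  by split; apply: BU => //; exact: pB.
have f_diff x y : B x -> B y -> `|f (p x) - f (p y)| <=
    2 * `|w (sigma x) - w (sigma y)| + `|f x - f y|.
  move=> Bx By; rewrite !fpB // /radial -/(sigma x) -/(sigma y).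
  set a := w _; set b := w _.
  (* The factor 2 of the estimate bounds the norm of [f x - o], both terms having norm at most 1. *)
  have -> : o + a *: (f x - o) - (o + b *: (f y - o)) =
      (a - b) *: (f x - o) + b *: (f x - f y).
    have -> : f x - f y = (f x - o) - (f y - o) by rewrite opprB addrA subrK.
    rewrite opprD addrACA subrr add0r; move: (f x - o) (f y - o) => u v.
    by rewrite scalerBl scalerBr addrA subrK.
  apply: le_trans (ler_normD _ _) _; apply: lerD; rewrite normrZ.
    rewrite mulrC ler_wpM2r //; apply: le_trans (ler_normB _ _) _.
    have := f_bound (BN _ Bx); have := f_bound (E_sub_N E_p0); rewrite /o; lra.
  rewrite -[leRHS]mul1r ler_wpM2r //.
  by have /andP[? ?] := w_01 (sigma y); rewrite ger0_norm.
have w_dist : exists2 K, 0 <= K & forall a b, `|w a - w b| <= K * `|a - b|.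
  have [K HK] := w_lip; exists `|K| => // a b.
  wlog ab : a b / a <= b.
    have [ab|/ltW ba] := leP a b; first exact.
    by rewrite distrC (distrC a); exact.
  rewrite distrC (distrC a) ger0_norm ?subr_ge0 ?w_nd //.
  by rewrite -normrM; apply: le_trans (HK _ _ ab) (ler_norm _).
have sd_dist u v : `|set_distance (f @` E) u - set_distance (f @` E) v| <= `|u - v|.
  have := set_distance_lipschitz fE_p0 u v.
  have := set_distance_lipschitz fE_p0 v u.
  by rewrite (distrC v) ler_norml => ? ?; apply/andP; split; lra.
exists p; split => //; last first.
  by move=> x y Bx By; split; [exact/BN/pB|exact/BN/pB|exact: f_diff].
split.
- apply/(continuous_dP dX) => x e e0.
  have [Bx|nBx] := pselect (B x).
    have [Nx xr] := Bx.
    have [_ [t t0 Ht]] := rstar_U Nx xr.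
    have [s s0 Hs] := f_inv_unif e0.
    have [K K0 HK] := w_dist.
    have [|q q0 Hq] := f_cont Nx (e := s / (2 * K + 1)).
      by rewrite divr_gt0 //; lra.
    have [|q' q'0 Hq'] := sigma_cont Nx (e := rstar - sigma x); first by lra.
    exists (Num.min t (Num.min q q')) => [|y]; first by rewrite !lt_min t0 q0.
    rewrite !lt_min => /andP[/Ht Ny /andP[/(Hq y Ny) xyq /(Hq' y Ny)[_ yr]]].
    have By : B y by split=> //; lra.
    apply: Hs; [exact/BN/pB|exact/BN/pB|].
    apply: le_lt_trans (f_diff x y Bx By) _.
    rewrite ltr_pdivlMr in xyq; last by lra.
    have := sd_dist (f x) (f y); rewrite -/(sigma x) -/(sigma y) => sxy.
    have := HK (sigma x) (sigma y).
    have := ler_wpM2l K0 sxy; lra.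
  have px : p x = x by exact: pC.
  (* Points that move have [sigma] below [r], while [x] has [sigma] at least [rstar] or lies off the
     closed set [N]; hence [p] is the identity near [x]. *)
  have [Nx|Nx] := pselect (N x).
    have xr : rstar <= sigma x.
      by rewrite leNgt; apply/negP => xr; apply: nBx; split.
    have [|q q0 Hq] := sigma_cont Nx (e := rstar - r); first by rewrite subr_gt0.
    exists (Num.min q e) => [|y]; first by rewrite lt_min q0.
    rewrite lt_min => /andP[xyq xye].
    by rewrite px p_id // => -[Ny yr]; have [] := Hq y Ny xyq; lra.
  have /(open_dP dX)/(_ x Nx)[q q0 Hq] := closed_openC N_closed.
  exists (Num.min q e) => [|y]; first by rewrite lt_min q0.
  rewrite lt_min => /andP[xyq xye].
  by rewrite px p_id // => -[Ny yr]; exact: Hq y xyq Ny.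
- move=> y; have [By|/pC py] := pselect (B y); last by exists y.
  have [Ny yr] := By.
  have [K K0 HK] := w_dist.
  set u := f y - o.
  have [u0|u0] := eqVneq u 0.
    exists p0; have Bp0 : B p0.
      split; first exact: E_sub_N.
      by have := (proj2 (sigma_E (E_sub_N E_p0))) E_p0; lra.
    apply: f_inj => //; first exact/BN/pB.
    rewrite fpB // /radial -/o subrr scaler0 addr0.
    by apply/esym/eqP; rewrite -subr_eq0 -/u u0.
  have u_gt0 : 0 < `|u| by rewrite normr_gt0.
  (* A preimage of [y] is sought on the ray from [o] through [f y], as a solution of [t * psi t = 1]
     given by the intermediate value theorem. *)
  pose psi t := w (set_distance (f @` E) (o + t *: u)).
  have psi_cont : continuous psi.
    move=> t; apply/cvgrPdist_lt => e e0; apply/nbhs_ballP.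
    exists (e / (K * `|u| + 1)) => [|t' /=].
      by rewrite /= divr_gt0 // ltr_wpDl // mulr_ge0.
    rewrite ltr_pdivlMr; last by rewrite ltr_wpDl // mulr_ge0.
    move=> tt'; apply: le_lt_trans (HK _ _) _.
    have := ler_wpM2l K0 (sd_dist (o + t *: u) (o + t' *: u)).
    have -> : o + t *: u - (o + t' *: u) = (t - t') *: u.
      by rewrite opprD addrACA subrr add0r scalerBl.
    rewrite normrZ => /le_lt_trans; apply; apply: le_lt_trans tt'.
    have := normr_ge0 (t - t'); rewrite mulrDr mulr1 mulrCA; lra.
  (* At this parameter the ray is at least [r + 2] away from [o], hence at least [r] away from the
     image of [E], which lies within 2 of [o]. *)
  pose top := Num.max 1 ((r + 2) / `|u|).
  have top1 : 1 <= top by rewrite le_max lexx.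
  have psi_top : psi top = 1.
    apply: w_eq1; apply: (set_distance_ge fE_p0) => _ [a Ea <-].
    have : (r + 2) <= `|top *: u|.
      by rewrite normrZ ger0_norm -?ler_pdivrMr ?le_max ?lexx ?orbT //; lra.
    have := f_bound (E_sub_N Ea); have := f_bound (E_sub_N E_p0); rewrite -/o.
    have := ler_normB (o + top *: u - f a) (o - f a).
    rewrite opprB addrA subrK addrAC subrr add0r.
    have := ler_normB o (f a); lra.
  have /andP[psi0 psi1] := w_01 (set_distance (f @` E) (o + 1 *: u)).
  have [||t] := @IVT R (fun t => t * psi t) 1 top 1 top1.
  - apply: continuous_subspaceT => t; apply: cvgM; first exact: cvg_id.
    exact: psi_cont.
  - rewrite psi_top mulr1 mul1r ge_min le_max top1 orbT andbT.
    by rewrite /psi psi1.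
  - rewrite in_itv /= => /andP[t1 _] tpsi.
  (* From level [r] on, [w] is 1, which forces [t = 1]: the point is then [f y] itself. *)
  have sd_t : set_distance (f @` E) (o + t *: u) < rstar.
    have [tr|tr] := ltP (set_distance (f @` E) (o + t *: u)) r; first lra.
    have t_eq1 : t = 1 by move: tpsi; rewrite /psi w_eq1 // mulr1.
    by rewrite t_eq1 scale1r subrKC.
  have [x Nx fx] := rstar_tube sd_t.
  have Bx : B x by split=> //; rewrite /sigma fx.
  exists x; apply: f_inj => //; first exact/BN/pB.
  rewrite fpB // /radial fx -/(psi t) (addrC o (t *: u)) addrK scalerA mulrC tpsi.
  by rewrite scale1r subrKC.
- move=> x y; split=> [pxy|[->//|[_ -> [Ex Ey]]]]; last first.
    have pE z : E z -> B z /\ f (p z) = o.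
      move=> Ez; have Bz : B z.
        split; first exact: E_sub_N.
        by have := (proj2 (sigma_E (E_sub_N Ez))) Ez; lra.
      split => //; rewrite fpB // /radial w_eq0 ?scale0r ?addr0 //.
      exact: (proj2 (sigma_E (E_sub_N Ez))).
    have [[Bx fx] [By fy]] := (pE x Ex, pE y Ey).
    by apply: f_inj; [exact/BN/pB|exact/BN/pB|rewrite fx fy].
  have [Bx|nBx] := pselect (B x); last first.
    have [By|nBy] := pselect (B y); last by left; move: pxy; rewrite !pC.
    by exfalso; have := pB y By; rewrite -pxy pC.
  have [By|nBy] := pselect (B y); last first.
    by exfalso; have := pB x Bx; rewrite pxy pC.
  have : radial (f x) = radial (f y) by rewrite -!fpB // pxy.
  move=> /addrI; rewrite -/(sigma x) -/(sigma y).
  have wE z : B z -> w (sigma z) *: (f z - o) = 0 -> E z.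
    move=> Bz /eqP; rewrite scaler_eq0 => /orP[/eqP wz|].
      apply/(sigma_E (BN _ Bz)); rewrite leNgt; apply/negP => /w_gt0.
      by rewrite wz ltxx.
    rewrite subr_eq0 => /eqP /f_inj -> //; first exact: BN.
    exact: E_sub_N.
  have [wx0|wx0] := eqVneq (w (sigma x) *: (f x - o)) 0.
    by rewrite wx0 => /esym wy0; right; exists E => //; split; exact: wE.
  (* Equal images put [f a] on the segment from [o] to [f b], so [sigma a <= sigma b] by
     starlikeness. Monotonicity of [w] then gives equal factors, which are nonzero. *)
  have inj_le a b : B a -> B b -> w (sigma a) *: (f a - o) != 0 ->
      w (sigma a) *: (f a - o) = w (sigma b) *: (f b - o) ->
      w (sigma b) <= w (sigma a) -> a = b.
    move=> Ba Bb; rewrite scaler_eq0 negb_or => /andP[wa0 _] ab wba.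
    have wa : 0 < w (sigma a).
      by rewrite lt_neqAle eq_sym wa0; case/andP: (w_01 (sigma a)).
    have fa : f a - o = (w (sigma b) / w (sigma a)) *: (f b - o).
      by rewrite mulrC -scalerA -ab scalerA mulVf // scale1r.
    have c01 : 0 <= w (sigma b) / w (sigma a) <= 1.
      rewrite ler_pdivrMr // mul1r wba andbT divr_ge0 //.
        by case/andP: (w_01 (sigma b)).
      exact: ltW.
    have sab : sigma a <= sigma b.
      rewrite /sigma -[f a](subrK o) fa addrC.
      apply: le_trans (set_distance_star fE_p0 fE_star _ c01) _.
      rewrite -[leRHS]mul1r ler_wpM2r ?(set_distance_ge0 fE_p0) //.
      by case/andP: c01.
    have wab : w (sigma b) = w (sigma a) by apply/eqP; rewrite eq_le wba w_nd.
    apply: f_inj; [exact: BN|exact: BN|].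
    by apply: (@addIr _ (- o)); rewrite fa wab divff // scale1r.
  move=> wxy; left.
  have [wle|/ltW wle] := leP (w (sigma y)) (w (sigma x)); first exact: inj_le.
  by apply/esym; apply: inj_le => //; rewrite -wxy.
Qed.
End profile.

(** The profile is a staircase of height [m], divided by [m], for the sets of levels of the members
    of [TT]. A member meeting the moving region is close to [E] and small, so the two terms of the
    estimate in [radial_collapse] add up to less than [s], the modulus of the inverse chart for
    [e]. *)
Lemma controlled_collapse (TT : set (set X)) e : 0 < e -> null_family d TT ->
  (forall T, TT T -> closed T) -> (forall T, TT T -> E `&` T = set0) ->
  exists p : X -> X,
  [/\ collapses p [set E],
      forall x, p x <> x -> U x /\ U (p x) &
      forall T, TT T -> (forall x, T x -> p x = x) \/ diam_le d (p @` T) e].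
Proof.
move=> e0 TTnull TTc ET.
have near_E := null_family_near dX TTnull TTc E_closed ET.
have [rho rho0 Hrho] := tube.
have [W [Wo EW WN]] := E_N.
have [||t t0 Ht] := @thick_nbhd _ _ _ dX E (W `&` U) E_closed.
- exact: openI.
- by move=> x Ex; split; [exact: EW|exact: E_U].
have [q q0 Hq] := sigma_near_E t0.
(* Below [rho] the chart covers the sublevel set; below [q] its points lie in [U] and in the
   interior of [N]. *)
pose rstar := Num.min rho q.
have rstar0 : 0 < rstar by rewrite lt_min rho0.
have [s s0 Hs] := f_inv_unif e0.
have [|eta eta0 Heta] := f_unif (e := s / 2); first by lra.
have [t1 t10 Ht1] := E_near_sigma rstar0.
have [|r1 r10 Hr1] := near_E (Num.min t1 (eta / 2)).
  by rewrite lt_min t10; lra.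
have [r2 r20 Hr2] := sigma_near_E r10.
pose r := Num.min r2 (rstar / 2).
have r0 : 0 < r by rewrite lt_min r20; lra.
have rr : r < rstar.
  by apply: (@le_lt_trans _ _ (rstar / 2)); [rewrite ge_min lexx orbT|lra].
(* Points outside the tube receive the default level [rstar], which exceeds [r], so the profile is
   already constant there. *)
pose level x := if pselect (N x /\ sigma x < rstar) then sigma x else rstar.
have levelE x : N x /\ sigma x < rstar -> level x = sigma x.
  by rewrite /level; case: pselect.
have levelN x : ~ (N x /\ sigma x < rstar) -> level x = rstar.
  by rewrite /level; case: pselect.
pose AA := [set level @` T | T in TT].
(* The chosen height satisfies [m > 8 / s], so twice the variation [2 / m] is below [s / 2]. The
   hypothesis on levels holds since a point at a tiny level is close to [E], and by nullity its
   whole member is then close to [E]. *)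
have [r' r'0|] := @staircase R AA _ (Num.trunc (8 / s)) r r0.
  have [|t' t'0 Ht'] := E_near_sigma (r := Num.min r' rstar).
    by rewrite lt_min r'0.
  have [u u0 Hu] := near_E _ t'0.
  have [v v0 Hv] := sigma_near_E u0.
  exists (Num.min v rstar); first by rewrite lt_min v0.
  move=> _ _ _ [T TTT <-] [x Tx <-] [y Ty <-]; rewrite lt_min => /andP[xv xr].
  have Bx : N x /\ sigma x < rstar.
    by apply: contrapT => /levelN xE; move: xr; rewrite xE ltxx.
  move: xv; rewrite levelE // => /(Hv x (proj1 Bx))[a Ea ax].
  have [_ /(_ y Ty) ay] := Hu T x a TTT Tx Ea ax.
  have [Ny _] := Ht' a y Ea ay; rewrite lt_min => /andP[yr' yr].
  by rewrite levelE.
move=> w [[w_nd [K wK] w0 wpos w_top] [w2 _]].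
set m := (Num.trunc (8 / s)).+1 in w_top.
have m0 : 0 < m%:R :> R by rewrite ltr0n.
have ms : 8 < m%:R * s.
  by rewrite -ltr_pdivrMr //; exact: truncnS_gt.
have [|||||||p [pE pU p_id p_diff]] :=
  @radial_collapse (fun a => w a / m%:R) r rstar r0 rr.
- by move=> a b ab; rewrite ler_pM2r ?invr_gt0 // w_nd.
- exists (K / m%:R) => a b ab; rewrite -mulrBl mulrAC ler_pM2r ?invr_gt0 //.
  exact: wK.
- by move=> a a0; rewrite w0 ?mul0r.
- by move=> a a0; rewrite divr_gt0 ?wpos.
- by move=> a ra; rewrite w_top // divff // gt_eqF.
- move=> v; rewrite lt_min => /andP[+ _].
  move=> /(set_distance_lt fE_p0)[_ [a Ea <-] av].
  by apply: Hrho Ea _; rewrite distrC.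
- move=> x Nx; rewrite lt_min => /andP[_ /(Hq x Nx)[a Ea ax]].
  have [Wx Ux] := Ht a x Ea ax; split => //.
  have /(open_dP dX)/(_ x Wx)[z z0 Hz] := Wo.
  by exists z => // y /Hz /WN.
exists p; split => // T TTT.
have [[x Tx [Nx xr]]|Hx] := pselect (exists2 x, T x & N x /\ sigma x < r); last first.
  by left=> x Tx; apply: p_id => Hxr; apply: Hx; exists x.
right=> _ _ [y Ty <-] [z Tz <-]; apply: ltW.
have [a Ea ax] : exists2 a, E a & d a x < r1.
  by apply: Hr2 => //; apply: lt_le_trans xr _; rewrite ge_min lexx.
have [Tdiam Tnear] := Hr1 T x a TTT Tx Ea ax.
have TB b : T b -> N b /\ sigma b < rstar.
  move=> /Tnear; rewrite lt_min => /andP[/(Ht1 a b Ea)[Nb _ br] _].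
  by split.
have [Ny Nz yz] := p_diff y z (TB y Ty) (TB z Tz).
apply: Hs => //; apply: le_lt_trans yz _.
have fyz : `|f y - f z| < s / 2.
  apply: Heta; [exact: proj1 (TB y Ty)|exact: proj1 (TB z Tz)|].
  have := Tdiam y z Ty Tz; rewrite le_min => /andP[_]; lra.
have wyz : `|w (sigma y) - w (sigma z)| <= 2.
  have TA : AA (level @` T) by exists T.
  rewrite -(levelE y (TB y Ty)) -(levelE z (TB z Tz)) ler_norml.
  have := w2 _ _ _ TA (imageP level Ty) (imageP level Tz).
  have := w2 _ _ _ TA (imageP level Tz) (imageP level Ty).
  by move=> ? ?; apply/andP; split; lra.
rewrite -mulrBl normrM [`|m%:R^-1|]ger0_norm ?invr_ge0 ?ler0n //.
have : `|w (sigma y) - w (sigma z)| / m%:R <= s / 4.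
  rewrite ler_pdivrMr //; lra.
lra.
Qed.

End radial_collapse.

(** * Recursively starlike-equivalent sets *)

Lemma dec_piP (X : topologicalType) (D : decomposition X) (x y : X) :
  dec_pi D x = dec_pi D y <-> x = y \/ exists2 A, elements D A & A x /\ A y.
Proof.
rewrite /dec_pi; split; first by move=> /eqmodP/asboolP.
by move=> xy; apply/eqmodP/asboolP.
Qed.

Lemma dec_pi_continuous (X : topologicalType) (D : decomposition X) :
  continuous (@dec_pi X D).
Proof. exact: pi_continuous. Qed.

Lemma enorm_ge_norm (R : realType) (n : nat) (v : 'rV[R]_n) : `|v| <= enorm v.
Proof.
rewrite [leLHS]/Num.norm /= mx_normrE; apply: bigmax_le; first exact: sqrtr_ge0.
move=> [i j] _ /=; rewrite -sqrtr_sqr ler_wsqrtr //.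
rewrite ord1 (bigD1 j) //= lerDl sumr_ge0 // => k _; exact: sqr_ge0.
Qed.

(** * From collapsing maps to quotient spaces *)

Section quotient_homeomorphism.
Context (R : realType) (X : topologicalType) (d : X -> X -> R).
Hypothesis dX : compact_metric d.

(** The homeomorphism is the projection after any section of [c]. It is continuous because [c],
    defined on a compact space with Hausdorff target, is a closed map. *)
Lemma collapses_homeomorphism (D : decomposition X) (c : X -> X) :
  collapses c D -> exists h : X -> dec_quot D,
    homeomorphism h /\ forall x, h (c x) = dec_pi D x.
Proof.
move=> [c_cont /choice[s cs] c_fibre].
exists (dec_pi D \o s).
have hc x : (dec_pi D \o s) (c x) = dec_pi D x.
  by apply/dec_piP/c_fibre; rewrite cs.
split => //; split.
  apply/continuous_closedP => K Kc.
  have -> : (dec_pi D \o s) @^-1` K = c @` (@dec_pi X D @^-1` K).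
    apply/seteqP; split=> [x Kx|_ [x Kx <-]]; first by exists (s x).
    by rewrite /preimage /= -/((dec_pi D \o s) (c x)) hc.
  apply: (closed_image dX) => //.
  by apply: closed_comp Kc => x _; exact: dec_pi_continuous.
exists (c \o repr); split.
- apply: repr_comp_continuous => // x y /eqP xy; apply/eqP/c_fibre.
  exact/dec_piP.
- by move=> x /=; rewrite -[RHS]cs; apply/c_fibre/dec_piP; rewrite /dec_pi reprK.
- by move=> z /=; rewrite -/((dec_pi D \o s) _) hc /dec_pi reprK.
Qed.

End quotient_homeomorphism.

Section starlike_collapse.
Context (R : realType) (X : topologicalType) (d : X -> X -> R).
Hypothesis dX : compact_metric d.

(** Quantifying over all null families lets the property be used after earlier collapses, on the
    images of the remaining elements. *)
Definition controlled_collapsible (E : set X) : Prop :=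
  forall (U : set X) (TT : set (set X)) (e : R),
  open U -> E `<=` U -> 0 < e -> null_family d TT ->
  (forall T, TT T -> closed T) -> (forall T, TT T -> E `&` T = set0) ->
  exists p : X -> X,
  [/\ collapses p [set E],
      forall x, p x <> x -> U x /\ U (p x) &
      forall T, TT T -> (forall x, T x -> p x = x) \/ diam_le d (p @` T) e].

Lemma starlike_collapsible (A E : set X) (a : X) (c : X -> X) :
  collapses c [set A] -> closed E ->
  starlike_equivalent R (@dec_pi X (collapse A) @` E) (dec_pi (collapse A) a) ->
  E a -> controlled_collapsible (c @` E).
Proof.
move=> cA Ec [n [N [f [[Nc [W [Wo EW WN]]] fN_disc]]]].
move=> [[f_cont [g [_ gf]]] fE_fN] _ [_ _ [rho [_ _ fE]]] Ea.
have [h [[h_cont [h' [_ hK h'K]]] hc]] := collapses_homeomorphism dX (D := collapse A) cA.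
move=> U TT e Uo EU e0 TTnull TTc ET.
have c_cont : continuous c by case: cA.
have fhE : (f \o h) @` (c @` E) = f @` (@dec_pi X (collapse A) @` E).
  apply/seteqP; split=> [_ [_ [x Ex <-] <-]|_ [_ [x Ex <-] <-]].
    by exists (dec_pi (collapse A) x); [exists x|rewrite -hc].
  by exists (c x); [exists x|rewrite -hc].
have fhN : (f \o h) @` (h @^-1` N) = f @` N.
  apply/seteqP; split=> [_ [x Nx <-]|_ [z Nz <-]]; first by exists (h x).
  by exists (h' z); rewrite /= /preimage /= h'K.
apply: (@controlled_collapse R X d dX _ (h @^-1` N) (c @` E) U (f \o h) (c a)) => //.
- by apply: closed_comp Nc => x _; exact: h_cont.
- exact: (closed_image dX).
- exists (h @^-1` W); split=> [|_ [x Ex <-]|x /WN //].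
    by apply: open_comp Wo => x _; exact: h_cont.
  by rewrite /preimage /= hc; apply: EW; exists x.
- by move=> x y Nx Ny /= /(congr1 g); rewrite !gf // => /(can_inj hK).
- move=> x r Nx r0; move/subspace_continuousP : f_cont => /(_ (h x) Nx).
  move=> /cvgrPdist_lt /(_ r r0); rewrite /within /= => /h_cont.
  by move=> /(nbhs_dP dX)[s s0 Hs]; exists s => // y Ny /Hs; exact.
- move=> x Nx; apply: le_trans (enorm_ge_norm _) _; apply: ltW.
  by apply: fN_disc; exists (h x).
- by rewrite fhE fhN.
- move=> v t; rewrite fhE fE /= hc => -[xi [s [/andP[s0 s_rho] ->]]] /andP[t0 t1].
  exists xi, (t * s); split; last first.
    by rewrite -[in RHS]scalerA; congr (_ + _ *: _); rewrite addrC addKr.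
  rewrite mulr_ge0 //=; apply: le_trans s_rho; rewrite -[leRHS]mul1r.
  exact: ler_wpM2r.
Qed.

(** Treats the last stage of the filtration, a single point, as a collapse too. *)
Lemma collapses_id (a : X) : collapses id [set [set a]].
Proof.
split=> [x|y|x y]; [exact: cvg_id|by exists y|].
by split=> [->|[//|[_ -> [-> ->]]]]; [left|].
Qed.

Lemma collapses_comp (p q : X -> X) (A E : set X) : A `<=` E ->
  collapses p [set A] -> collapses q [set p @` E] -> collapses (q \o p) [set E].
Proof.
move=> AE [pc ps pf] [qc qs qf]; split.
- by move=> x; apply: continuous_comp; [exact: pc|exact: qc].
- by move=> y; have [x <-] := qs y; have [z <-] := ps x; exists z.
have pE x : (p @` E) (p x) -> E x.
  by move=> [y Ey /pf [<-//|[_ -> [_ /AE]]]].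
move=> x y; split=> [/qf [/pf[->|[_ -> [Ax Ay]]]|[_ -> [px py]]]|].
- by left.
- by right; exists E => //; split; exact: AE.
- by right; exists E => //; split; exact: pE.
- move=> [->//|[_ -> [Ex Ey]]]; apply/qf; right; exists (p @` E) => //.
Qed.

(** The second collapse is controlled on the images under the first. The bound [e] does not degrade:
    [q] either makes the image of a member small or fixes it pointwise, leaving the alternative
    obtained for [p]. *)
Lemma recursively_starlike_collapsible (E : set X) :
  recursively_starlike_equivalent R 1 E -> controlled_collapsible E.
Proof.
move=> [a [F [F0 F2 FS Fc Fstar]]].
have F1a : F 1%N a by apply: (FS 1%N) => //; rewrite F2.
have F01 : F 1%N `<=` E by rewrite -F0; exact: (FS 0%N).
have Ec : closed E by rewrite -F0; exact: Fc.
have F1c : closed (F 1%N) by exact: Fc.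
have coll1 : controlled_collapsible (F 1%N).
  rewrite -[F 1%N]image_id; apply: starlike_collapsible (collapses_id a) F1c _ F1a.
  by rewrite -F2; exact: (Fstar 1%N).
move=> U TT e Uo EU e0 TTnull TTc ET.
have [||p [pA pU pT]] := coll1 U TT e Uo _ e0 TTnull TTc.
- exact: subset_trans F01 EU.
- move=> T /ET; rewrite -!subset0 => H x [/F01 Ex Tx]; exact: H.
have [p_cont p_surj p_fibre] := pA.
have pUU x : U x -> U (p x).
  by have [->//|/pU[]] := pselect (p x = x).
have coll2 : controlled_collapsible (p @` E).
  apply: starlike_collapsible pA Ec _ _; last exact: F01 F1a.
  by rewrite -F0; exact: (Fstar 0%N).
have [|||q [qE qU qT]] :=
  coll2 U [set p @` T | T in TT] e Uo _ e0 (null_family_image dX p_cont TTnull).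
- by move=> _ [x /EU/pUU Ux <-].
- by move=> _ [T TTT <-]; apply: (closed_image dX p_cont (TTc T TTT)).
- move=> _ [T TTT <-]; rewrite -subset0 => _ [[x Ex <-] [y Ty /p_fibre]].
  have := ET T TTT; rewrite -subset0 => H.
  case=> [yx|[_ -> [/F01 Ey _]]]; last by apply: (H y).
  by apply: (H x); split=> //; rewrite -yx.
exists (q \o p); split=> [|x qpx|T TTT].
- exact: collapses_comp pA qE.
- have [px|px] := pselect (p x = x).
    by rewrite /= px in qpx *; exact: qU.
  have [Ux Upx] := pU x px; split=> //.
  by have [/= ->//|/qU[]] := pselect (q (p x) = p x).
- have [qpT|] := qT (p @` T) (ex_intro2 _ _ T TTT erefl); last first.
    by rewrite image_comp; right.
  have qpE x : T x -> q (p x) = p x by move=> Tx; apply: qpT; exists x.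
  have [pT'|pT'] := pT T TTT; first by left=> x Tx /=; rewrite qpE ?pT'.
  right=> _ _ [x Tx <-] [y Ty <-] /=; rewrite !qpE //.
  by apply: pT'; [exists x|exists y].
Qed.

End starlike_collapse.

(** * Collapsing a null decomposition *)

Lemma dependent_sequence (S : Type) (I : nat -> S -> Prop)
    (step : nat -> S -> S -> Prop) (s0 : S) : I 0%N s0 ->
  (forall n s, I n s -> exists s', I n.+1 s' /\ step n s s') ->
  exists u : nat -> S,
    u 0%N = s0 /\ forall n, I n (u n) /\ step n (u n) (u n.+1).
Proof.
move=> I0 Hstep.
have /choice[f Hf] : forall ns : nat * S, exists s',
    I ns.1 ns.2 -> I ns.1.+1 s' /\ step ns.1 ns.2 s'.
  move=> [n s]; have [/Hstep[s' Hs']|nI] := pselect (I n s); first by exists s'.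
  by exists s.
pose u := fix u n := if n is n'.+1 then f (n', u n') else s0.
have Iu n : I n (u n) by elim: n => // n /(Hf (n, u n))[].
by exists u; split => // n; split => //; exact: (proj2 (Hf (n, u n) (Iu n))).
Qed.

Lemma halving_lt (R : realType) (u : nat -> R) (e : R) :
  (forall n, u n.+1 <= u n / 2) -> 0 < e -> exists n, u n < e.
Proof.
move=> uS e0.
have uE n : u n * 2 ^+ n <= u 0%N.
  elim: n => [|n IH]; first by rewrite expr0 mulr1.
  apply: le_trans IH; rewrite exprS mulrA ler_wpM2r ?exprn_ge0 //.
  by have := uS n; lra.
have [n] : exists n, u 0%N / e < n%:R.
  by exists (Num.trunc (u 0%N / e)).+1; exact: truncnS_gt.
rewrite ltr_pdivrMr // => un; exists n.
have p0 : 0 < 2 ^+ n :> R by rewrite exprn_gt0.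
rewrite -(ltr_pM2r p0); apply: le_lt_trans (uE n) _; apply: lt_trans un _.
by rewrite mulrC ltr_pM2l // -natrX ltr_nat ltn_expl.
Qed.

Section decomposition_collapse.
Context (R : realType) (X : topologicalType) (d : X -> X -> R).
Hypothesis dX : compact_metric d.
Implicit Types (e r s t : R) (x y z : X).

Lemma collapses_setU (p q : X -> X) (AA : set (set X)) (E : set X) :
  collapses p AA -> collapses q [set E] ->
  (forall x, E x -> p x = x) -> (forall x, E (p x) -> E x) ->
  collapses (q \o p) (E |` AA).
Proof.
move=> [pc ps pf] [qc qs qf] pE Ep; split.
- by move=> x; apply: continuous_comp; [exact: pc|exact: qc].
- by move=> y; have [x <-] := qs y; have [z <-] := ps x; exists z.
move=> x y; split=> [/qf [/pf[->|[A AAA Axy]]|[_ -> [px py]]]|].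
- by left.
- by right; exists A => //; right.
- by right; exists E; [left|split; exact: Ep].
- move=> [->//|[A [->|AAA] [Ax Ay]]]; apply/qf.
    by right; exists E => //; rewrite !pE.
  by left; apply/pf; right; exists A.
Qed.

Section disjoint_family.
Context (DD : set (set X)).
Hypothesis DD_null : null_family d DD.
Hypothesis DD_closed : forall E, DD E -> closed E.
Hypothesis DD_trivI : trivIset DD id.
Hypothesis DD_coll : forall E, DD E -> controlled_collapsible d E.

Let DD_eq E F x : DD E -> DD F -> E x -> F x -> E = F.
Proof. by move=> DE DF Ex Fx; apply: DD_trivI => //; exists x. Qed.

Definition near_set (E : set X) r : set X := [set x | exists2 a, E a & d a x < r].

(** By induction on [L]. The head and the union of the tail are at distance at least [r];
    restricting each support to an [r / 2]-neighbourhood keeps the two collapses from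
    interacting. *)
Lemma finite_collapse (L : seq (set X)) (Z : set X) t e :
  uniq L -> (forall E, E \in L -> DD E) -> closed Z ->
  (forall E, E \in L -> E `&` Z = set0) -> 0 < t -> 0 < e ->
  exists p : X -> X,
  [/\ collapses p [set` L],
      forall x, p x <> x ->
        (exists2 E, E \in L & near_set E t x /\ near_set E t (p x)) /\
        ~ Z x /\ ~ Z (p x) &
      forall T, DD T -> T \notin L ->
        (forall x, T x -> p x = x) \/ diam_le d (p @` T) e].
Proof.
elim: L Z => [|E L IH] Z; rewrite /= => uL DL Zc LZ t0 e0.
  exists id; split=> [|//|T _ _]; last by left.
  split=> [x|y|x y]; [exact: cvg_id|by exists y|].
  by split=> [->|[//|[]//]]; left.
have /andP[EL uL'] := uL.
have DE : DD E by apply: DL; rewrite mem_head.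
have DL' F : F \in L -> DD F by move=> FL; apply: DL; rewrite inE FL orbT.
set B := \bigcup_(F in [set` L]) F.
have Bc : closed B.
  by apply: closed_bigcup => [|F /DL'/DD_closed//]; exact: finite_seq.
have EB : E `&` (B `|` Z) = set0.
  rewrite setIUr LZ ?mem_head // setU0 -subset0 => x [Ex [F FL Fx]].
  by move: EL; rewrite (DD_eq DE (DL' F FL) Ex Fx) FL.
have [r r0 Hr] := separation dX (DD_closed DE) (closedU Bc Zc) EB.
have r2 : 0 < r / 2 by lra.
(* Adding the complement of the neighbourhood of [B] to the fixed set confines the support of [p']
   to that neighbourhood. *)
have [||p' [p'L p'Z p'T]] := IH (Z `|` ~` near_set B (r / 2)) uL' DL' _ _ t0 e0.
- by apply: closedU => //; apply: open_closedC; exact: (open_nbhd dX).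
- move=> F FL; rewrite setIUr LZ ?inE ?FL ?orbT // set0U -subset0.
  move=> x [Fx]; apply; exists x; first by exists F.
  by rewrite (dxx dX).
have E_far x : E x -> ~ near_set B (r / 2) x.
  by move=> Ex [b Bb bx]; have := Hr x b Ex (or_introl Bb); rewrite (dC dX); lra.
have p'_near x : p' x <> x -> near_set B (r / 2) x /\ near_set B (r / 2) (p' x).
  by move=> /p'Z[_ [nx npx]]; split; apply: contrapT => H;
    [apply: nx|apply: npx]; right.
have p'E x : E x -> p' x = x.
  by move=> Ex; apply: contrapT => /p'_near[/(E_far _ Ex)].
have Ep' x : E (p' x) -> E x.
  move=> Epx; have [<-//|/p'_near[_]] := pselect (p' x = x).
  by move=> /(E_far _ Epx).
pose s := Num.min t (r / 2).
have s0 : 0 < s by rewrite lt_min t0.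
have p'_cont : continuous p' by case: p'L.
have [|||||q [qE qU qT]] := DD_coll DE (U := near_set E s `&` ~` Z)
    (TT := [set p' @` T | T in [set T | DD T /\ T \notin E :: L]]) _ _ e0.
- by apply: openI; [exact: (open_nbhd dX)|exact: closed_openC].
- move=> x Ex; split; first by exists x => //; rewrite (dxx dX).
  by move=> Zx; have : (E `&` Z) x by []; rewrite LZ ?mem_head.
- apply: (null_family_image dX p'_cont) => f f0.
  by apply: sub_finite_set (DD_null f0) => T [[]].
- by move=> _ [T [DT _] <-]; apply: (closed_image dX) => //; exact: DD_closed.
- move=> _ [T [DT TL] <-]; rewrite -subset0 => z [Ez [x Tx xE]].
  rewrite -xE in Ez; have Ex := Ep' _ Ez.
  by move: TL; rewrite (DD_eq DT DE Tx Ex) mem_head.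
have q_far x : near_set B (r / 2) x -> q x = x.
  move=> [b Bb bx]; apply: contrapT => /qU[[[a Ea]]].
  rewrite lt_min => /andP[_ ax] _ _; have := Hr a b Ea (or_introl Bb).
  have := d_triangle dX a x b; rewrite (dC dX x b); lra.
have near_s x : near_set E s x -> near_set E t x.
  by move=> [a Ea]; rewrite lt_min => /andP[]; exists a.
exists (q \o p'); split=> [|x /= qpx|T DT TL].
- have -> : [set` E :: L] = E |` [set` L].
    apply/seteqP; split=> [F /=|F [->|/= FL]] /=; rewrite ?inE ?eqxx ?FL ?orbT //.
    by move=> /orP[/eqP|]; [left|right].
  exact: collapses_setU p'L qE p'E Ep'.
- have [p'x|p'x] := pselect (p' x = x).
    rewrite p'x in qpx *; have [[Ux nZx] [Uqx nZqx]] := qU x qpx.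
    by split=> //; exists E; rewrite ?mem_head //; split; exact: near_s.
  rewrite q_far; last by case: (p'_near x p'x).
  have [[F FL Fx] [nx npx]] := p'Z x p'x; split.
    by exists F; rewrite ?inE ?FL ?orbT.
  by split=> Zx; [apply: nx|apply: npx]; left.
- have [qpT|] := qT (p' @` T) (ex_intro2 _ _ T (conj DT TL) erefl); last first.
    by rewrite image_comp; right.
  have qpE x : T x -> q (p' x) = p' x by move=> Tx; apply: qpT; exists x.
  have TL' : T \notin L by move: TL; rewrite inE negb_or => /andP[].
  have [pT'|pT'] := p'T T DT TL'; first by left=> x Tx /=; rewrite qpE ?pT'.
  right=> _ _ [x Tx <-] [y Ty <-] /=; rewrite !qpE //.
  by apply: pT'; [exists x|exists y].
Qed.

(** * Stages of the infinite collapse *)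

Context (K : set X).
Hypothesis K_closed : closed K.
Hypothesis DD_K : forall E, DD E -> E `&` K = set0.

(** [pc_closed] allows the elements already collapsed to be held fixed at the next stage. *)
Record partial_collapse (P : X -> X) (AA : set (set X)) r : Prop :=
  PartialCollapse {
    pc_collapses : collapses P AA;
    pc_sub : AA `<=` DD;
    pc_closed : closed (\bigcup_(A in AA) A);
    pc_id : forall x, K x -> P x = x;
    pc_diam : forall T, DD T -> diam_le d (P @` T) r }.

(* Precomposing with [p], rather than postcomposing, keeps the supports near the
   original elements, where the charts are given. *)
Lemma partial_collapse_step P AA r e t : partial_collapse P AA r ->
  0 <= r -> 0 < e -> 0 < t -> exists p AA',
  [/\ partial_collapse (P \o p) AA' e,
      forall x, d (P (p x)) (P x) <= r + e &
      forall x, p x <> x ->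
        exists2 E, DD E & near_set E t x /\ near_set E t (p x)].
Proof.
move=> [PAA AD AAc PK PD] r0 e0 t0.
have [P_cont P_surj P_fibre] := PAA.
have [|h h0 Hh] := unif_cont dX P_cont (e := e / 2); first by lra.
(* These are the elements to collapse at this stage; uniform continuity of [P] bounds their
   diameters from below, so nullity leaves finitely many. *)
pose bad := [set T | DD T /\ ~ diam_le d (P @` T) e].
have bad_fin : finite_set bad.
  have h2 : 0 < h / 2 by lra.
  apply: sub_finite_set (DD_null h2) => T [DT PT]; split=> // Th; apply: PT.
  move=> _ _ [x Tx <-] [y Ty <-].
  have := Th x y Tx Ty; have := Hh x y; lra.
have [L0 HL0] := (proj1 (finite_seqP bad)) bad_fin.
pose L := undup L0.
have LP T : T \in L <-> bad T by rewrite mem_undup HL0.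
(* Supports within [h] of the elements cost at most [e / 2] after applying [P]; images of diameter
   at most [h / 2] end up with diameter at most [e / 2]. *)
have [|||||p [pL pZ pT]] := @finite_collapse L (K `|` \bigcup_(A in AA) A)
    (Num.min t h) (h / 2) (undup_uniq _).
- by move=> E /LP[].
- exact: closedU.
(* A bad element is not in [AA], since [P] maps members of [AA] to points. *)
- move=> E /LP[DE PE]; rewrite setIUr DD_K // set0U -subset0 => x [Ex [A AAA Ax]].
  apply: PE => _ _ [y Ey <-] [z Ez <-].
  rewrite (proj2 (P_fibre y z)) ?(dxx dX) ?(ltW e0) //; right; exists A => //.
  by rewrite -(DD_eq DE (AD _ AAA) Ex Ax).
- by rewrite lt_min t0.
- by lra.
have [p_cont p_surj p_fibre] := pL.
have p_id x : (K `|` \bigcup_(A in AA) A) x -> p x = x.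
  by move=> Zx; apply: contrapT => /pZ[_ []].
have p_AA A x : AA A -> A (p x) <-> A x.
  move=> AAA; split=> Ax; last by rewrite p_id //; right; exists A.
  have [<-//|/pZ[_ [_ []]]] := pselect (p x = x).
  by right; exists A.
have near_t E x s : near_set E (Num.min t s) x -> near_set E t x.
  by move=> [a Ea]; rewrite lt_min => /andP[]; exists a.
exists p, (AA `|` [set` L]); split.
- split.
  + split.
    * by move=> x; apply: continuous_comp; [exact: p_cont|exact: P_cont].
    * by move=> y; have [x <-] := P_surj y; have [z <-] := p_surj x; exists z.
    * move=> x y; split=> [/P_fibre[/p_fibre[->|[A LA Axy]]|[A AAA]]|].
      - by left.
      - by right; exists A => //; right.
      - by rewrite !p_AA // => Axy; right; exists A => //; left.
      - move=> [->//|[A [AAA|LA] Axy]].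
          by apply/P_fibre; right; exists A; rewrite ?p_AA.
        by rewrite /= (proj2 (p_fibre x y)) //; right; exists A.
  + by move=> A [/AD//|/LP[]].
  + rewrite bigcup_setU; apply: closedU => //.
    by apply: closed_bigcup => [|A /LP[/DD_closed]//]; exact: finite_seq.
  + by move=> x Kx; rewrite /= p_id ?PK //; left.
  + move=> T DT _ _ [x Tx <-] [y Ty <-] /=.
    have [TL|TL] := boolP (T \in L).
      rewrite (proj2 (p_fibre x y)) ?(dxx dX) ?(ltW e0) //.
      by right; exists T.
    have [pTx|pTh] := pT T DT TL.
      rewrite !pTx //; apply: contrapT => H.
      move: TL => /negP; apply; apply/LP; split=> // PT; apply: H.
      by apply: PT; [exists x|exists y].
    apply/ltW/(@lt_trans _ _ (e / 2)); last by lra.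
    apply: Hh; have := pTh (p x) (p y) (imageP p Tx) (imageP p Ty); lra.
- move=> x.
  have [->|/pZ[[E EL [[a Ea ax] [b Eb bx]]] _]] := pselect (p x = x).
    by rewrite (dxx dX); lra.
  (* Both [x] and [p x] are near [E], so the displacement is at most the diameter [r] of the image
     of [E] plus two errors [e / 2]. *)
  move: ax bx; rewrite !lt_min => /andP[_ /Hh ax] /andP[_ /Hh bx].
  have [DE _] := (proj1 (LP E)) EL.
  have := PD E DE _ _ (imageP P Eb) (imageP P Ea).
  have := d_triangle dX (P (p x)) (P b) (P x).
  have := d_triangle dX (P b) (P a) (P x).
  rewrite (dC dX _ (P b)); lra.
- move=> x /pZ[[E EL [nx npx]] _]; exists E; first by have [] := (proj1 (LP E)) EL.
  by split; apply: near_t; [exact: nx|exact: npx].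
Qed.

(** * The uniformity of the quotient *)

Definition dec_equivalent x y : Prop := x = y \/ exists2 A, DD A & A x /\ A y.

(* The entourages of the uniformity of the quotient, pulled back to [X]. *)
Definition near_equivalent r x y : Prop := exists x' y',
  [/\ dec_equivalent x' y', d x x' < r & d y y' < r].

Lemma dec_equivalent_sym x y : dec_equivalent x y -> dec_equivalent y x.
Proof. by move=> [->|[A DA [Ax Ay]]]; [left|right; exists A]. Qed.

Lemma dec_equivalent_trans x y z :
  dec_equivalent x y -> dec_equivalent y z -> dec_equivalent x z.
Proof.
move=> [->//|[A DA [Ax Ay]]] [<-|[B DB [By Bz]]]; first by right; exists A.
by right; exists A => //; split=> //; rewrite (DD_eq DA DB Ay By).
Qed.

Lemma near_equivalent_sym r x y : near_equivalent r x y -> near_equivalent r y x.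
Proof.
by move=> [x' [y' [xy xx yy]]]; exists y', x'; split=> //; exact: dec_equivalent_sym.
Qed.

Lemma near_equivalent_le r s x y : r <= s ->
  near_equivalent r x y -> near_equivalent s x y.
Proof. by move=> rs [x' [y' [? ? ?]]]; exists x', y'; split=> //; lra. Qed.

Lemma near_equivalent_perturb r x y v w : near_equivalent r v w ->
  d x v < r -> d y w < r -> near_equivalent (2 * r) x y.
Proof.
move=> [v' [w' [vw vv ww]]] xv yw; exists v', w'; split => //.
  by have := d_triangle dX x v v'; lra.
by have := d_triangle dX y w w'; lra.
Qed.

(** For distinct [x] and [y], approximating pairs of distinct equivalent points lie in elements of
    diameter above [e]. These are finitely many and closed, so one that comes close enough to [x]
    and [y] contains both. *)
Lemma near_equivalent_closed x y :
  (forall r, 0 < r -> near_equivalent r x y) -> dec_equivalent x y.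
Proof.
move=> xy; have [->|/(d_gt0 dX) xy0] := pselect (x = y); first by left.
pose e := d x y / 4; have e0 : 0 < e by rewrite /e; lra.
have away z : exists2 r, 0 < r & forall T x',
    DD T -> ~ diam_le d T e -> T x' -> d z x' < r -> T z.
  pose B := [set T | DD T /\ ~ diam_le d T e /\ ~ T z].
  have /closed_openC/(open_dP dX)/(_ z)[|r r0 Hr] : closed (\bigcup_(T in B) T).
  - apply: closed_bigcup => [|T [/DD_closed//]].
    by apply: sub_finite_set (DD_null e0) => T [DT [Te _]].
  - by move=> [T [_ [_]]].
  exists r => // T x' DT Te Tx' zx'; apply: contrapT => Tz.
  by apply: Hr zx' _; exists T.
have [[r1 r10 H1] [r2 r20 H2]] := (away x, away y).
pose r := Num.min e (Num.min r1 r2).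
have r0 : 0 < r by rewrite !lt_min e0 r10.
have [x' [y' [xy']]] := xy r r0.
rewrite !lt_min => /andP[xe /andP[x1 x2]] /andP[ye /andP[y1 y2]].
have far : e < d x' y'.
  have := d_triangle dX x x' y; have := d_triangle dX x' y' y.
  by rewrite (dC dX y' y) /e in xe ye *; lra.
case: xy' => [x'y'|[T DT [Tx' Ty']]].
  by move: far; rewrite x'y' (dxx dX); lra.
have Te : ~ diam_le d T e by move=> /(_ x' y' Tx' Ty'); lra.
by right; exists T => //; split; [exact: H1 Tx' x1|exact: H2 Ty' y2].
Qed.

(** By compactness, triples violating this for ever smaller [s] cluster at a triple [a], [b], [c]
    whose consecutive terms are equivalent; then [a] and [c] are equivalent, and triples close to
    them are no violation. *)
Lemma near_equivalent_trans r : 0 < r -> exists s, [/\ 0 < s, s <= r &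
  forall x y z, near_equivalent s x y -> near_equivalent s y z ->
    near_equivalent r x z].
Proof.
move=> r0; apply: contrapT => H.
pose s n := Num.min r n.+1%:R^-1.
have s0 n : 0 < s n by rewrite lt_min r0 invr_gt0 ltr0n.
have /choice[u Hu] : forall n, exists v : X * X * X,
    [/\ near_equivalent (s n) v.1.1 v.1.2, near_equivalent (s n) v.1.2 v.2 &
        ~ near_equivalent r v.1.1 v.2].
  move=> n; apply: contrapT => K'; apply: H; exists (s n); split => //.
    by rewrite ge_min lexx.
  move=> x y z xy yz; apply: contrapT => xz; apply: K'.
  by exists (x, y, z).
have [a [b [c [phi Hphi]]]] := cluster_triple dX
  (fun n => (u n).1.1) (fun n => (u n).1.2) (fun n => (u n).2).
have small e : 0 < e -> exists n, [/\ d a (u n).1.1 < e, d b (u n).1.2 < e,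
    d c (u n).2 < e & s n < e].
  move=> /ltr_add_invr[k]; rewrite add0r => ke.
  exists (phi k); have [kphi ? ? ?] := Hphi k; split; try exact: lt_trans ke.
  apply: le_lt_trans ke; rewrite ge_min; apply/orP; right.
  by rewrite lef_pV2 ?posrE ?ltr0n // ler_nat ltnS.
have ab : dec_equivalent a b.
  apply: near_equivalent_closed => e e0.
  have [|n [an bn cn sn]] := small (e / 2); first by lra.
  have [uv _ _] := Hu n.
  have := near_equivalent_perturb (near_equivalent_le (ltW sn) uv) an bn.
  by rewrite mulrC divfK.
have bc : dec_equivalent b c.
  apply: near_equivalent_closed => e e0.
  have [|n [an bn cn sn]] := small (e / 2); first by lra.
  have [_ uv _] := Hu n.
  have := near_equivalent_perturb (near_equivalent_le (ltW sn) uv) bn cn.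
  by rewrite mulrC divfK.
have [n [an bn cn sn]] := small r r0.
have [_ _] := Hu n; apply; exists a, c; split.
- exact: dec_equivalent_trans ab bc.
- by rewrite (dC dX).
- by rewrite (dC dX).
Qed.

Lemma decomposition_collapses : exists F : X -> X,
  collapses F DD /\ forall x, K x -> F x = x.
Proof.
have [M M0 dM] := d_bounded dX.
(* The entourage at [t n.+1] composed with itself lies in the one at [t n], so any finite run of
   later displacements stays inside [t n]. *)
have [|t [_ Ht]] := @dependent_sequence R (fun _ t => 0 < t)
  (fun _ t t' => t' <= t / 2 /\ forall x y z,
    near_equivalent t' x y -> near_equivalent t' y z -> near_equivalent t x z)
  1 ltr01.
  move=> _ r r0; have [s [s0 sr Hs]] := near_equivalent_trans r0.
  exists (Num.min s (r / 2)); split; first by rewrite lt_min s0; lra.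
  split=> [|x y z xy yz]; first by rewrite ge_min lexx orbT.
  by apply: (Hs x y z); [move: xy|move: yz]; apply: near_equivalent_le;
    rewrite ge_min lexx.
(* As [M] bounds all distances, the identity is a valid stage 0. *)
pose del n := M / 2 ^+ n.
have del0 n : 0 < del n by rewrite divr_gt0 ?exprn_gt0.
have delS n : del n.+1 = del n / 2 by rewrite /del exprSr invfM mulrA.
have [|n [P AA] PAA|u [_ Hu]] := @dependent_sequence
  ((X -> X) * set (set X)) (fun n S => partial_collapse S.1 S.2 (del n))
  (fun n S S' => exists p : X -> X,
    [/\ S'.1 = S.1 \o p, forall x, d (S'.1 x) (S.1 x) <= 2 * del n &
      forall x, near_equivalent (t n.+1) (p x) x]) (id, set0).
- split => //=.
  + split=> [x|y|x y]; [exact: cvg_id|by exists y|].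
    by split=> [->|[->//|[]//]]; left.
  + by rewrite bigcup_set0; exact: closed0.
  + by move=> T _ _ _ [x _ <-] [y _ <-]; rewrite /del expr0 divr1.
- have [p [AA' [PAA' Pp ptheta]]] :=
    partial_collapse_step PAA (ltW (del0 n)) (del0 n.+1) (proj1 (Ht n.+1)).
  exists (P \o p, AA'); split => //; exists p; split=> // x.
    by have := Pp x; rewrite delS /=; have := del0 n; lra.
  have [px|/ptheta[E DE [[a Ea ax] [b Eb bx]]]] := pselect (p x = x).
    by exists x, x; rewrite px (dxx dX) (proj1 (Ht n.+1)); split=> //; left.
  by exists b, a; rewrite (dC dX _ b) (dC dX _ a); split=> //; right; exists E.
pose P n := (u n).1.
have PAA n : partial_collapse (P n) (u n).2 (del n) by case: (Hu n).
have P_cont n : continuous (P n) by case: (pc_collapses (PAA n)).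
have P_surj n : forall y, exists x, P n x = y by case: (pc_collapses (PAA n)).
(* Telescoping, with [2 * del m = 4 * (del m - del m.+1)]. *)
have P_close n k x : d (P (n + k)%N x) (P n x) <= 4 * (del n - del (n + k)%N).
  elim: k => [|k IH]; first by rewrite addn0 (dxx dX) subrr mulr0.
  rewrite addnS; have [_ [p [_ /(_ x) Pp _]]] := Hu (n + k)%N.
  have := d_triangle dX (P (n + k).+1 x) (P (n + k)%N x) (P n x).
  by rewrite delS; rewrite -!/(P _) in Pp; lra.
(* Later stages precompose, so [P (n + k)] is [P n] after a run of displacements, which compose to
   one within [t n]. *)
have P_factor n k x : exists2 z, P (n + k)%N x = P n z & near_equivalent (t n) z x.
  elim: k n => [|k IH] n.
    rewrite addn0; exists x => //; exists x, x; rewrite (dxx dX).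
    by have [] := Ht n; split=> //; left.
  have [z Pz zx] := IH n.+1; have [_ [p [Pp _ Hp]]] := Hu n.
  exists (p z); first by rewrite addnS -addSn Pz /P Pp.
  by have [_ [_ Htt]] := Ht n; apply: Htt (Hp z) zx.
have /choice[F HF] x : exists y, forall n, d y (P n x) <= 4 * del n.
  have [y Hy] := cluster_sequence dX (P ^~ x); exists y => n.
  apply/ler_addgt0Pr => e e0; have [m nm ym] := Hy e n e0.
  have := P_close n (m - n)%N x; rewrite subnKC //.
  have := d_triangle dX y (P m x) (P n x); have := del0 m; lra.
have del_le m n : (m <= n)%N -> del n <= del m.
  move=> mn; rewrite ler_wpM2l ?(ltW M0) // lef_pV2 ?posrE ?exprn_gt0 //.
  by rewrite ler_weXn2l // ler1n.
have del_small e : 0 < e -> exists n, del n < e.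
  by apply: halving_lt => n; rewrite delS.
have F_cont : continuous F.
  apply/(continuous_dP dX) => x e e0.
  have [|n ne] := del_small (e / 12); first by lra.
  have /(continuous_dP dX)/(_ x (e / 3))[|r r0 Hr] := P_cont n; first by lra.
  exists r => // y /Hr xy; have := HF x n; have := HF y n.
  rewrite (dC dX (F y)); have := d_triangle dX (F x) (P n x) (F y).
  have := d_triangle dX (P n x) (P n y) (F y); lra.
have d_small x y : (forall e, 0 < e -> d x y < e) -> x = y.
  move=> H; apply: contrapT => /(d_gt0 dX)/H; by rewrite ltxx.
exists F; split; last first.
  move=> x Kx; apply: d_small => e e0.
  have [|n ne] := del_small (e / 4); first by lra.
  by have := HF x n; rewrite (pc_id (PAA n) Kx); lra.
split => //.
(* Preimages of [y] under the maps [P n] cluster at a preimage under [F]. *)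
- move=> y; have /choice[s Hs] : forall n, exists x, P n x = y by [].
  have [x Hx] := cluster_sequence dX s; exists x; apply: d_small => e e0.
  have [|n ne] := del_small (e / 8); first by lra.
  have /(continuous_dP dX)/(_ x (e / 2))[|r r0 Hr] := F_cont; first by lra.
  have [m nm /Hr xm] := Hx r n r0.
  have := HF (s m) m; rewrite Hs; have := d_triangle dX (F x) (F (s m)) y.
  by have := del_le _ _ nm; lra.
- move=> x y; split=> [Fxy|[->//|[T DT [Tx Ty]]]]; last first.
    apply: d_small => e e0.
    have [|n ne] := del_small (e / 9); first by lra.
    have := pc_diam (PAA n) DT (imageP _ Tx) (imageP _ Ty).
    have := HF x n; have := HF y n; rewrite (dC dX (F y)).
    have := d_triangle dX (F x) (P n x) (F y).
    have := d_triangle dX (P n x) (P n y) (F y); lra.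
  (* The points [v k] and [w k], close to [x] and [y] in the entourage [t n], have [P n]-images
     converging to [F x] and [F y]. Their cluster points [a] and [b] satisfy [P n a = P n b], hence
     are equivalent, and the chain [x], [a], [b], [y] has three steps in [s']. *)
  apply: near_equivalent_closed => r r0.
  have [s [s0 sr Hs]] := near_equivalent_trans r0.
  have [s' [s'0 s's Hs']] := near_equivalent_trans s0.
  have [m||n ns'] := @halving_lt R t (s' / 2); first by case: (Ht m) => _ [].
    by lra.
  have /choice[v Hv] k : exists z, P (n + k)%N x = P n z /\ near_equivalent (t n) z x.
    by have [z] := P_factor n k x; exists z.
  have /choice[w Hw] k : exists z, P (n + k)%N y = P n z /\ near_equivalent (t n) z y.
    by have [z] := P_factor n k y; exists z.
  have [a [b [c' [phi Hphi]]]] := cluster_triple dX v w w.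
  have lim z c (q : nat -> X) : (forall k, P (n + k)%N z = P n (q k)) ->
      (forall k, d c (q (phi k)) < k.+1%:R^-1) -> P n c = F z.
    move=> Hq Hc; apply: d_small => e e0.
    have /(continuous_dP dX)/(_ c (e / 2))[|h h0 Hh] := P_cont n; first by lra.
    have [|m me] := del_small (e / 8); first by lra.
    have /ltr_add_invr[k] := h0; rewrite add0r => kh.
    pose j := maxn k m; have [jphi _ _ _] := Hphi j.
    have : d c (q (phi j)) < h.
      apply: lt_le_trans (Hc j) (le_trans _ (ltW kh)).
      by rewrite lef_pV2 ?posrE ?ltr0n // ler_nat ltnS leq_maxl.
    move=> /Hh; rewrite -Hq; have := HF z (n + phi j)%N; rewrite (dC dX (F z)).
    have : del (n + phi j)%N <= del m.
      apply: del_le; apply: leq_trans (leq_addl _ _); apply: leq_trans jphi.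
      exact: leq_maxr.
    have := d_triangle dX (P n c) (P (n + phi j)%N z) (F z); lra.
  have ab : dec_equivalent a b.
    have [_ _ P_fibre] := pc_collapses (PAA n).
    have Pa : P n a = F x by apply: (lim x a v) => k; [case: (Hv k)|case: (Hphi k)].
    have Pb : P n b = F y by apply: (lim y b w) => k; [case: (Hw k)|case: (Hphi k)].
    have /P_fibre[->|[A AAA Aab]] : P n a = P n b by rewrite Pa Pb.
    - by left.
    - by right; exists A => //; exact: pc_sub (PAA n) _ AAA.
  have tn0 : 0 < t n by case: (Ht n).
  have /ltr_add_invr[k] := tn0; rewrite add0r => kt.
  have [_ av bw _] := Hphi k.
  have near_lim z c (q : nat -> X) : near_equivalent (t n) (q (phi k)) z ->
      d c (q (phi k)) < k.+1%:R^-1 -> near_equivalent s' c z.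
    move=> qz cq; apply: near_equivalent_le (near_equivalent_perturb qz _ _).
    - by lra.
    - exact: lt_trans cq kt.
    - by rewrite (dxx dX).
  have xa : near_equivalent s' x a.
    apply: near_equivalent_sym; apply: near_lim av; by case: (Hv (phi k)).
  have by_ : near_equivalent s' b y.
    by apply: near_lim bw; case: (Hw (phi k)).
  have ab' : near_equivalent s' a b by exists a, b; rewrite !(dxx dX).
  apply: Hs (Hs' _ _ _ xa ab') (near_equivalent_le s's by_).
Qed.

End disjoint_family.
End decomposition_collapse.

(** * The bidisc *)

Section bidisc.
Context (R : realType).

Lemma enorm_continuous n : continuous (@enorm R n).
Proof.
move=> v; apply: (@continuous_comp _ _ _ (fun v : 'rV[R]_n => \sum_i v ord0 i ^+ 2)
  (@Num.sqrt R)); last exact: sqrt_continuous.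
apply: continuous_big; first exact: add_continuous.
move=> i _ {}v; apply: (@continuous_comp _ _ _ (fun v : 'rV[R]_n => v ord0 i)
  (fun x : R => x ^+ 2)).
  exact: coord_continuous.
exact: exprn_continuous.
Qed.

Lemma disc_compact n : compact (@disc R n).
Proof.
apply: bounded_closed_compact.
  exists 1; split => // M M1 v /= v1; apply: le_trans (enorm_ge_norm v) _.
  exact: le_trans v1 (ltW M1).
rewrite [X in closed X](_ : _ = @enorm R n @^-1` [set x | x <= 1]) //.
by apply: closed_comp (@closed_le R 1) => x _; exact: enorm_continuous.
Qed.

Lemma val_disc_continuous n : continuous (fun x : @disc R n => val x : 'rV[R]_n).
Proof. exact: initial_continuous. Qed.

Lemma nbhs_disc n (x : @disc R n) V : nbhs x V <->
  exists2 e : R, 0 < e & forall y : @disc R n, `|val x - val y : 'rV[R]_n| < e -> V y.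
Proof.
split=> [[_ [[W Wo <-] /= Wx WV]]|[e e0 He]].
  have /nbhs_ballP[e /= e0 He] : nbhs (val x : 'rV[R]_n) W.
    exact: open_nbhs_nbhs.
  by exists e => // y xy; apply/WV/He; rewrite -ball_normE.
have : nbhs (val x : 'rV[R]_n) (ball (val x : 'rV[R]_n) e) by exact: nbhsx_ballx.
move=> /(@val_disc_continuous n x).
apply: (@filterS _ _ (nbhs_filter x)) => y /=.
by rewrite -ball_normE => /He.
Qed.

(** A cluster point found in the ambient space lies in the disc and pulls back through the initial
    topology. *)
Lemma disc_type_compact n : compact [set: @disc R n].
Proof.
move=> F FF _.
have [|v [vD vF]] := @disc_compact n ((fun x : @disc R n => val x : 'rV[R]_n) @ F).
  by apply: (@filterS _ F _ setT) filterT => x _; exact: set_mem (valP x).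
exists (exist _ v (mem_set vD)); split=> // A B FA /nbhs_disc[e e0 He].
have [||_ [[x Ax <-] vx]] := vF [set val x | x in A] (ball v e).
- by apply: (@filterS _ F) FA => x Ax; exists x.
- exact: nbhsx_ballx.
by exists x; split=> //; apply: He; move: vx; rewrite -ball_normE.
Qed.

(* Nullity for [bidisc_dist] passes to any smaller metric (up to a constant), and
   this one avoids proving the Euclidean triangle inequality. *)
Definition sup_dist (x y : bidisc R) : R :=
  `|val x.1 - val y.1 : 'rV[R]_2| + `|val x.2 - val y.2 : 'rV[R]_2|.

Lemma sup_dist_le x y : sup_dist x y <= 2 * bidisc_dist x y.
Proof.
have sqrt_ge (a b : R) : 0 <= a -> a <= Num.sqrt (a ^+ 2 + b ^+ 2).
  move=> a0; rewrite -[leLHS](ger0_norm a0) -sqrtr_sqr ler_wsqrtr //.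
  by rewrite lerDl sqr_ge0.
rewrite mulr_natl mulr2n; apply: lerD; apply: le_trans (enorm_ge_norm _) _.
  by apply: sqrt_ge; exact: sqrtr_ge0.
by rewrite /bidisc_dist [X in _ <= Num.sqrt X]addrC; apply: sqrt_ge; exact: sqrtr_ge0.
Qed.

Lemma sup_dist_compact : compact_metric sup_dist.
Proof.
split.
- by move=> x; rewrite /sup_dist !subrr normr0 addr0.
- move=> [x1 x2] [y1 y2]; rewrite /sup_dist /= => /eqP.
  rewrite paddr_eq0 // !normr_eq0 !subr_eq0 => /andP[/eqP/val_inj -> /eqP/val_inj ->].
  by [].
- by move=> x y; rewrite /sup_dist distrC (distrC (val x.2)).
- move=> x y z; rewrite /sup_dist addrACA.
  by apply: lerD; exact: ler_distD.
- move=> [x1 x2] V; split=> [[[A B] [/nbhs_disc[a a0 Ha] /nbhs_disc[b b0 Hb]] ABV]|].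
    exists (Num.min a b) => [|[y1 y2]]; first by rewrite lt_min a0.
    rewrite /sup_dist /= lt_min => /andP[xa xb]; apply: ABV; split => /=.
      by apply: Ha; apply: le_lt_trans xa; rewrite lerDl.
    by apply: Hb; apply: le_lt_trans xb; rewrite lerDr.
  move=> [e e0 He]; exists ([set y | `|val x1 - val y : 'rV[R]_2| < e / 2],
      [set y | `|val x2 - val y : 'rV[R]_2| < e / 2]).
    by split; apply/nbhs_disc; exists (e / 2) => //; lra.
  by move=> [y1 y2] [/= h1 h2]; apply: He; rewrite /sup_dist /=; lra.
- have -> : [set: bidisc R] = [set: @disc R 2] `*` [set: @disc R 2].
    by apply/seteqP.
  by apply: compact_setX; exact: disc_type_compact.
Qed.

Lemma bidisc_boundary_closed : closed (@bidisc_boundary R).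
Proof.
have sphere_closed (f : bidisc R -> @disc R 2) : continuous f ->
    closed [set x | @sphere R 2 (val (f x))].
  move=> fc.
  rewrite [X in closed X](_ : _ = (fun x => enorm (val (f x))) @^-1` [set 1 : R]) //.
  apply: closed_comp; last exact: closed_eq.
  move=> x _; apply: (@continuous_comp _ _ _ (fun x => val (f x) : 'rV[R]_2)
    (@enorm R 2)); last exact: enorm_continuous.
  by apply: continuous_comp; [exact: fc|exact: val_disc_continuous].
apply: (@closedU _ [set x : bidisc R | @sphere R 2 (val x.1)]
  [set x : bidisc R | @sphere R 2 (val x.2)]).
  by apply: (sphere_closed fst) => x; exact: cvg_fst.
by apply: (sphere_closed snd) => x; exact: cvg_snd.
Qed.

Lemma null_collection_family (DD : set (set (bidisc R))) :
  null_collection (@bidisc_dist R) DD -> null_family sup_dist DD.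
Proof.
move=> DDnull e e0; have e2 : 0 < e / 2 by lra.
apply: sub_finite_set (DDnull _ e2) => T [DT Te]; split=> //.
have [x [y [Tx Ty xy]]] : exists x y, [/\ T x, T y & e < sup_dist x y].
  apply: contrapT => H; apply: Te => x y Tx Ty; rewrite leNgt; apply/negP => xy.
  by apply: H; exists x, y.
apply: (@lt_le_trans _ _ (bidisc_dist x y)%:E); last first.
  by apply: ereal_sup_ubound; exists (x, y).
by rewrite lte_fin; have := sup_dist_le x y; lra.
Qed.

End bidisc.

Theorem theorem3p4 (R : realType) (D : decomposition (bidisc R))
    (C : set (bidisc R)) :
  null_collection (@bidisc_dist R) D ->
  (forall E, elements D E -> recursively_starlike_equivalent R 1 E) ->
  (forall E, elements D E -> E `&` @bidisc_boundary R = set0) ->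
  closed C ->
  neighbourhood (@attaching_region R) C ->
  (forall E, elements D E -> E `&` C = set0) ->
  exists h : bidisc R -> dec_quot D,
    [/\ homeomorphism h,
        h @` @attaching_region R = @dec_pi _ D @` @attaching_region R &
        forall x, (C `|` @bidisc_boundary R) x -> h x = @dec_pi _ D x].
Proof.
move=> Dnull Dstar Dbd Cc [W [_ attW WC]] DC.
have dX := sup_dist_compact R.
(* Elements may accumulate on the boundary, but its union with [C] is closed and misses each of
   them, so it can be held fixed. *)
have [||||F [FD FK]] := @decomposition_collapses R (bidisc R) _ dX D
    (null_collection_family Dnull) _ (@elements_disjoint _ D) _
    (C `|` @bidisc_boundary R).
- by move=> E /Dstar[e [G [<- _ _ Gc _]]]; exact: Gc.
- by move=> E /Dstar; exact: recursively_starlike_collapsible dX E.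
- by apply: closedU => //; exact: bidisc_boundary_closed.
- by move=> E DE; rewrite setIUr DC // Dbd // setU0.
have [h [h_homeo hF]] := collapses_homeomorphism dX FD.
have hK x : (C `|` @bidisc_boundary R) x -> h x = dec_pi D x.
  by move=> Kx; rewrite -hF FK.
exists h; split => //.
(* The attaching region lies in [C], where [h] agrees with the projection. *)
by apply: eq_imagel => x /attW/WC Cx; apply: hK; left.
Qed.
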